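(* Let $G$ be a finite, connected graph that contains at least one cycle. Then $D'(G)\leq D(G)$.
   Context: All graphs are simple. For a graph $G$, ${\rm Aut}(G)$ denotes its automorphism group. A vertex labeling $\phi: V(G)\to\{1,\dots,r\}$ is distinguishing if the only automorphism $\alpha\in{\rm Aut}(G)$ with $\phi(\alpha(x))=\phi(x)$ for all $x\in V(G)$ is the identity. The distinguishing number $D(G)$ is the smallest $r$ such that $G$ admits a distinguishing vertex labeling with $r$ labels. Analogously, an edge labeling $\psi:E(G)\to\{1,\dots,d\}$ is distinguishing if the only automorphism of $G$ preserving all edge labels (i.e. $\psi(\alpha(x)\alpha(y))=\psi(xy)$ for every edge $xy$) is the identity; the distinguishing index $D'(G)$ is the smallest $d$ such that $G$ admits a distinguishing edge labeling with $d$ labels. *)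

(* Defs.v *)
From Stdlib Require Import ClassicalDescription.
From mathcomp Require Import all_boot all_fingroup.
Set Implicit Arguments. Unset Strict Implicit. Unset Printing Implicit Defensive.

Definition simple_graph (T : finType) (e : rel T) : Prop :=
  symmetric e /\ irreflexive e.

Definition connected_graph (T : finType) (e : rel T) : Prop :=
  forall x y : T, connect e x y.

Definition has_cycle (T : finType) (e : rel T) : Prop :=
  exists p : seq T, [/\ 2 < size p, uniq p & path.cycle e p].

Definition is_aut (T : finType) (e : rel T) (a : {perm T}) : Prop :=
  forall x y : T, e (a x) (a y) = e x y.

(* Vertex labeling with r labels (labels 0..r-1 stand for 1..r). *)
Definition vlabeling (T : finType) (r : nat) (phi : T -> nat) : Prop :=
  forall x, phi x < r.

Definition vdistinguishing (T : finType) (e : rel T) (phi : T -> nat) : Prop :=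
  forall a : {perm T}, is_aut e a -> (forall x, phi (a x) = phi x) -> a = 1%g.

(* Edge labeling with d labels: psi x y is the label of edge xy (only
   values on edges matter; it must not depend on the orientation). *)
Definition elabeling (T : finType) (e : rel T) (d : nat) (psi : T -> T -> nat) : Prop :=
  forall x y, e x y -> psi x y < d /\ psi x y = psi y x.

Definition edistinguishing (T : finType) (e : rel T) (psi : T -> T -> nat) : Prop :=
  forall a : {perm T}, is_aut e a ->
    (forall x y, e x y -> psi (a x) (a y) = psi x y) -> a = 1%g.

Definition has_vdist (T : finType) (e : rel T) (r : nat) : Prop :=
  exists phi, vlabeling r phi /\ vdistinguishing e phi.

Definition has_edist (T : finType) (e : rel T) (d : nat) : Prop :=
  exists psi, elabeling e d psi /\ edistinguishing e psi.

Definition decP (P : Prop) : bool :=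
  if excluded_middle_informative P then true else false.

Lemma decPP (P : Prop) : decP P -> P.
Proof. by rewrite /decP; case: excluded_middle_informative. Qed.

Lemma decPI (P : Prop) : P -> decP P.
Proof. by rewrite /decP; case: excluded_middle_informative. Qed.

Lemma has_vdist_card (T : finType) (e : rel T) : has_vdist e #|T|.
Proof.
exists (fun x => nat_of_ord (enum_rank x)); split=> [x|a _ Ha].
  exact: ltn_ord.
apply/permP=> x; rewrite perm1; apply: enum_rank_inj; apply: val_inj.
exact: Ha.
Qed.

Lemma ex_has_vdist (T : finType) (e : rel T) :
  exists r, (fun r => decP (has_vdist e r)) r.
Proof. by exists #|T|; apply: decPI; apply: has_vdist_card. Qed.

Definition dist_number (T : finType) (e : rel T) : nat :=
  ex_minn (ex_has_vdist e).

(* Distinguishing index D'(G): least d admitting a distinguishing edge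
   labeling with d labels (defined as 0 if none exists; the theorem below
   also asserts existence). *)
Definition dist_index (T : finType) (e : rel T) : nat :=
  match excluded_middle_informative (exists d, (fun d => decP (has_edist e d)) d)
  with
  | left h => ex_minn h
  | right _ => 0
  end.

(* Main.v *)
Require Import Defs.
From mathcomp Require Import all_boot all_fingroup.
From Stdlib Require Import Classical.
From mathcomp Require Import zify.
(** Start from a distinguishing vertex labeling [c] with [r] labels, and give the
    edge from a vertex to its parent in a breadth-first tree the label of that
    vertex. An automorphism preserving the edge labels and the root set then
    preserves [c] off the root set, so it remains to choose the root set and the
    labels of the edges inside it.
    - If [r > 2], the root set is a cycle without the label 0, made recognizable
      by labelling all edges outside it and the tree with 0; a suitable word on
      the cycle makes it rigid, unless [r = 3] and all cycles have length 4, where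
      degrees in the core help, or [r = 3] and some cycle is odd, where
      [c x + c y] modulo 3 works for all edges [xy].
    - If the core (the largest subgraph of minimum degree 2) is a cycle, it is the
      root set.
    - If [r = 2], the root set is the core and [c x + c y] modulo 2 works unless
      an automorphism exchanges the two labels on the core. In that case the label
      of a single edge [bx] is changed. If an automorphism preserving the new
      labels moved this edge, the edge and its image would form an edge cut; [bx]
      is chosen in a minimal region bounded by such a cut, so that one side of
      the cut is a path of vertices of degree 2. *)

Set Implicit Arguments. Unset Strict Implicit. Unset Printing Implicit Defensive.

(** * Breadth-first levels over a root set, and edge labels that encode vertex labels *)

Section Levels.
Variables (T : finType) (e : rel T) (R : {set T}).

Definition ball n : {set T} :=
  iter n (fun B : {set T} => B :|: [set y | [exists x in B, e x y]]) R.

Lemma ball_edge n x y : x \in ball n -> e x y -> y \in ball n.+1.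
Proof.
by move=> xB exy; rewrite !inE; apply/orP; right; apply/existsP; exists x; apply/andP.
Qed.

Lemma ball_reach : connected_graph e -> R != set0 -> forall x, exists n, x \in ball n.
Proof.
move=> conn /set0Pn[z zR] x; have {zR}: z \in ball 0 by [].
have /connectP[p] := conn z x; elim: p z 0 => [|y p IHp] z n /=.
  by move=> _ -> zB; exists n.
by move=> /andP[ezy pth] lst zB; apply: IHp pth lst _; exact: ball_edge zB ezy.
Qed.

Hypothesis reach : forall x, exists n, x \in ball n.

Definition level x := ex_minn (reach x).

Lemma level_le n x : x \in ball n -> level x <= n.
Proof. by rewrite /level; case: ex_minnP => m _ H /H. Qed.

Lemma ball_level x : x \in ball (level x).
Proof. by rewrite /level; case: ex_minnP. Qed.

Lemma level_eq0 x : (level x == 0) = (x \in R).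
Proof.
apply/idP/idP => [/eqP l0|xR]; first by have := ball_level x; rewrite l0.
by rewrite -leqn0; exact: level_le.
Qed.

(** The choice among the lower neighbours is arbitrary, so automorphisms need not commute with
    [parent]; only levels are invariant. The default value [x] is taken on the root set. *)
Definition parent x := odflt x [pick y | e x y && (level y < level x)].

Lemma parentP (e_sym : symmetric e) x :
  x \notin R -> e x (parent x) /\ level (parent x) < level x.
Proof.
move=> xR; rewrite /parent; case: pickP => [y /andP[]//|none].
have := ball_level x; move: (level_eq0 x); rewrite (negPf xR).
case lx: (level x) => [//|n] _; rewrite !inE => /orP[/level_le|]; first by rewrite lx ltnn.
case/existsP=> y /andP[/level_le yn exy].
by have := none y; rewrite e_sym exy lx ltnS yn.
Qed.

Lemma level_aut (a : {perm T}) :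
  is_aut e a -> (forall x, (a x \in R) = (x \in R)) -> forall x, level (a x) = level x.
Proof.
move=> aut aR.
have aB n x : (a x \in ball n) = (x \in ball n).
  elim: n x => [|n IHn] x; first exact: aR.
  rewrite !inE IHn; congr (_ || _); apply/existsP/existsP => -[y /andP[yB eyx]].
    by exists (a^-1%g y); rewrite -IHn -aut !permKV yB.
  by exists (a y); rewrite IHn aut yB.
move=> x; apply/eqP; rewrite eqn_leq !level_le ?aB ?ball_level //.
by rewrite -aB ball_level.
Qed.

(* A vertex off the root set [R] passes its label to the edge towards its
   parent; edges inside [R] are labelled by [w]. *)
Definition encoding (c : T -> nat) (w : T -> T -> nat) x y : nat :=
  if (x \in R) && (y \in R) then w x y
  else if (x \notin R) && (y == parent x) then c x
  else if (y \notin R) && (x == parent y) then c y else 0.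

Variables (c : T -> nat) (w : T -> T -> nat).
Hypothesis e_sym : symmetric e.

Lemma parent_asym x y :
  x \notin R -> y \notin R -> y == parent x -> x != parent y.
Proof.
move=> xR yR /eqP yx; apply/eqP => xy.
have [_] := parentP e_sym xR; have [_] := parentP e_sym yR.
by rewrite -yx -xy => h /(ltn_trans h); rewrite ltnn.
Qed.

Lemma encodingC : (forall x y, w x y = w y x) ->
  forall x y, encoding c w x y = encoding c w y x.
Proof.
move=> wC x y; rewrite /encoding [(y \in R) && _]andbC; case: ifP => // _.
case: ifP => [/andP[xR yx]|_]; case: ifP => [/andP[yR xy]|_] //.
by have := parent_asym xR yR yx; rewrite xy.
Qed.

Lemma encoding_lt r : 0 < r -> (forall x, c x < r) -> (forall x y, w x y < r) ->
  forall x y, encoding c w x y < r.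
Proof. by move=> r0 cr wr x y; rewrite /encoding; do 3!case: ifP => _ //. Qed.

Variable a : {perm T}.
Hypotheses (aut : is_aut e a)
  (pres : forall x y, e x y -> encoding c w (a x) (a y) = encoding c w x y).
Hypothesis aR : forall x, (a x \in R) = (x \in R).

Lemma encoding_root x y : x \in R -> y \in R -> e x y -> w (a x) (a y) = w x y.
Proof. by move=> xR yR /pres; rewrite /encoding !aR xR yR. Qed.

(** The image of the edge from [x] to its parent has a nonzero label and is not inside [R], so it is
    a tree edge. As [a] preserves levels, its lower end is the image of the parent, and its label is
    [c (a x)]. *)
Lemma encoding_off_neq0 x : x \notin R -> c x != 0 -> c (a x) = c x.
Proof.
move=> xR cx; have [ex lx] := parentP e_sym xR.
have := pres ex; rewrite {2}/encoding (negPf xR) /= eqxx /encoding !aR (negPf xR) /=.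
case: ifP => // _; case: ifP => [/andP[yR /eqP axy]|_]; last by move=> c0; rewrite -c0 in cx.
have yaR : a (parent x) \notin R by rewrite aR.
have [_] := parentP e_sym yaR; rewrite -axy !level_aut // => h.
by have := ltn_trans h lx; rewrite ltnn.
Qed.
End Levels.

Section Encoding.
Variables (T : finType) (e : rel T) (R : {set T}).
Hypothesis reach : forall x, exists n, x \in ball e R n.
Variables (c : T -> nat) (w : T -> T -> nat).
Hypothesis e_sym : symmetric e.

Definition preserves (psi : T -> T -> nat) (a : {perm T}) :=
  forall x y, e x y -> psi (a x) (a y) = psi x y.

Lemma is_autV (a : {perm T}) : is_aut e a -> is_aut e a^-1.
Proof. by move=> aut x y; rewrite -aut !permKV. Qed.

Lemma is_autM (a b : {perm T}) : is_aut e a -> is_aut e b -> is_aut e (a * b).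
Proof. by move=> auta autb x y; rewrite !permM autb auta. Qed.

Lemma preservesV psi (a : {perm T}) : is_aut e a -> preserves psi a -> preserves psi a^-1.
Proof.
move=> aut pres x y exy; rewrite -(pres (a^-1%g x)) ?permKV //.
by rewrite (is_autV aut).
Qed.

(** The label 0 also marks edges outside the tree, so it says nothing by itself; a vertex labelled 0
    with an image labelled otherwise is excluded by the nonzero case for the inverse of [a]. *)
Lemma encoding_off (a : {perm T}) : is_aut e a ->
    preserves (encoding reach c w) a -> (forall x, (a x \in R) = (x \in R)) ->
  forall x, x \notin R -> c (a x) = c x.
Proof.
move=> aut pres aR x xR.
have [cx|cx] := eqVneq (c x) 0; last exact: encoding_off_neq0 pres aR _ _ _.
rewrite cx; have [//|cax] := eqVneq (c (a x)) 0.
have aVR z : (a^-1%g z \in R) = (z \in R) by rewrite -aR permKV.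
have axR : a x \notin R by rewrite aR.
have := encoding_off_neq0 e_sym (is_autV aut) (preservesV aut pres) aVR axR cax.
by rewrite permK cx => <-.
Qed.
End Encoding.
(** The tree edges take care of all vertices off the root set, which leaves two tasks: recognizing
    the root set and recovering [c] on it. *)
Lemma has_edist_of_encoding (T : finType) (e : rel T) (R : {set T})
    (reach : forall x, exists n, x \in ball e R n)
    (c : T -> nat) (w : T -> T -> nat) r :
    symmetric e -> vlabeling r c -> vdistinguishing e c -> 0 < r ->
    (forall x y, w x y < r) -> (forall x y, w x y = w y x) ->
    (forall a : {perm T}, is_aut e a -> preserves e (encoding reach c w) a ->
       (forall x, (a x \in R) = (x \in R)) /\ {in R, forall x, c (a x) = c x}) ->
  has_edist e r.
Proof.
move=> e_sym cr dist r0 wr wC H; exists (encoding reach c w); split.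
  by move=> x y _; split; [exact: encoding_lt|exact: encodingC].
move=> a aut pres; have [aR acR] := H a aut pres.
apply: dist => // x; have [xR|xR] := boolP (x \in R); first exact: acR.
exact: encoding_off pres _ _ _.
Qed.

(** * Rotations and reflections of a cycle *)

Section CycleStructure.
Variables (T : finType) (p : seq T).
Hypotheses (p_uniq : uniq p) (p_size : 2 < size p).

Lemma cycle_ind (P : T -> Prop) x0 : x0 \in p -> P x0 ->
  {in p, forall x, P x -> P (next p x)} -> {in p, forall x, P x}.
Proof.
move=> x0p Px0 step x; rewrite -(fconnect_cycle (cycle_next p_uniq) x0p) => /iter_findex <-.
elim: findex => //= n IHn; apply: step => //.
by elim: n {IHn} => //= n IHn; rewrite mem_next.
Qed.

Lemma next_neq_prev x : x \in p -> next p x != prev p x.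
Proof.
move=> xp; case: (rot_to xp) => i s rs; rewrite -(next_rot i) // -(prev_rot i) // rs.
move: p_uniq p_size; rewrite -(rot_uniq i) -(size_rot i) rs.
case: s {rs} => [|y [|z s]] //; rewrite next_nth prev_nth mem_head => /and3P[xs ys _] _.
rewrite (memNindex xs) [index _ _]/= eqxx; apply: contraNneq ys => /= ->.
by rewrite -[nth _ _ _]/(nth x (z :: s) (size (z :: s)).-1) nth_last /= mem_last.
Qed.

Lemma next2_neq x : x \in p -> next p (next p x) != x.
Proof.
move=> xp; apply: contraNneq (next_neq_prev xp) => nnx.
by rewrite -{2}nnx prev_next.
Qed.

Definition cycle_aut (f : T -> T) :=
  forall x, x \in p ->
    f x \in p /\ (f (next p x) = next p (f x) \/ f (next p x) = prev p (f x)).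

Variable f : T -> T.
Hypotheses (f_inj : injective f) (f_aut : cycle_aut f).

(** A change of direction at the successor of [x] would give [f] the same value at [x] and two steps
    further; these are distinct vertices since the cycle has more than two. Hence an injective [f]
    is a rotation or a reflection throughout. *)
Lemma cycle_aut_next x0 : x0 \in p -> f (next p x0) = next p (f x0) ->
  {in p, forall x, f (next p x) = next p (f x)}.
Proof.
move=> x0p fx0; apply: (cycle_ind x0p fx0) => x xp fx.
have nxp : next p x \in p by rewrite mem_next.
have [_ [//|]] := f_aut nxp; rewrite {1}fx prev_next // => /f_inj/eqP.
by rewrite (negPf (next2_neq xp)).
Qed.

Lemma cycle_aut_prev x0 : x0 \in p -> f (next p x0) = prev p (f x0) ->
  {in p, forall x, f (next p x) = prev p (f x)}.
Proof.
move=> x0p fx0; apply: (cycle_ind x0p fx0) => x xp fx.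
have nxp : next p x \in p by rewrite mem_next.
have [_ [|//]] := f_aut nxp; rewrite {1}fx next_prev // => /f_inj/eqP.
by rewrite (negPf (next2_neq xp)).
Qed.

Lemma cycle_aut_id x0 : x0 \in p -> f x0 = x0 -> f (next p x0) = next p x0 ->
  {in p, forall x, f x = x}.
Proof.
move=> x0p fx0 fnx0; apply: (cycle_ind x0p fx0) => x xp fx.
by rewrite (@cycle_aut_next x0) ?fx ?fx0.
Qed.
End CycleStructure.

(** * Encodings rooted at a cycle *)

Section CycleRoot.
Variables (T : finType) (e : rel T) (p : seq T) (c : T -> nat) (w : T -> T -> nat) (r : nat).
Hypotheses (e_sym : symmetric e) (conn : connected_graph e).
Hypotheses (p_uniq : uniq p) (p_size : 2 < size p) (p_cycle : path.cycle e p).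
Hypotheses (cr : vlabeling r c) (dist : vdistinguishing e c).
Hypotheses (wr : forall x y, w x y < r) (wC : forall x y, w x y = w y x).
Hypothesis (w_gt0 : {in p, forall x, 0 < w x (next p x)}).

(* The edges with a nonzero label other than those of [p] join a vertex to its
   parent, so that [p] is the only cycle with nonzero labels: on another one, a
   vertex of maximal level would have two parents. *)
Lemma has_edist_of_cycle :
    (forall a : {perm T}, is_aut e a -> cycle_aut p a ->
       {in p, forall x, w (a x) (a (next p x)) = w x (next p x)} ->
       {in p, forall x, a x = x}) ->
  has_edist e r.
Proof.
move=> rigid; pose R := [set x in p].
have [x0 x0p] : exists x0, x0 \in p by case: p p_size => // x s _; exists x; rewrite mem_head.
have R0 : R != set0 by apply/set0Pn; exists x0; rewrite inE.
(* Chords of the cycle get the label 0, so that none of them can be the image of an edge of the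
   cycle. *)
pose w' x y := if (y == next p x) || (x == next p y) then w x y else 0.
have w'C x y : w' x y = w' y x by rewrite /w' orbC wC.
have r0 : 0 < r by apply: leq_ltn_trans (wr x0 x0).
apply: (@has_edist_of_encoding _ _ _ (ball_reach conn R0) c w') => //.
  by move=> x y; rewrite /w'; case: ifP.
move=> a aut pres; set psi := encoding _ _ _ in pres; pose lv := level (ball_reach conn R0).
have en x : x \in p -> e x (next p x) by exact: next_cycle.
have psiC x y : psi x y = psi y x by exact: encodingC.
have psi0 x : x \in p -> 0 < psi x (next p x).
  by move=> xp; rewrite /psi /encoding !inE mem_next xp /= /w' eqxx w_gt0.
have up x y : x \notin R -> lv y <= lv x -> 0 < psi x y -> y = parent (ball_reach conn R0) x.
  move=> xR yx; rewrite /psi /encoding (negPf xR) /=.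
  case: ifP => [/eqP//|_]; case: ifP => // /andP[yR /eqP xy].
  by have [_] := parentP (ball_reach conn R0) e_sym yR; rewrite -xy ltnNge -/lv yx.
case: (arg_maxnP (fun x => lv (a x)) x0p) => x /= xp xmax'.
have {xmax'}xmax y : y \in p -> lv (a y) <= lv (a x) by exact: xmax'.
have axp : a x \in R.
  apply/negPn/negP => axR.
  have nx : a (next p x) = parent (ball_reach conn R0) (a x).
    by apply: up => //; [apply: xmax; rewrite mem_next|rewrite pres ?psi0 ?en].
  have px : a (prev p x) = parent (ball_reach conn R0) (a x).
    have pxp : prev p x \in p by rewrite mem_prev.
    apply: up => //; first exact: xmax.
    rewrite pres; last by rewrite e_sym; exact: prev_cycle.
    by rewrite psiC -{2}(next_prev p_uniq x) psi0.
  have : parent (ball_reach conn R0) (a x) != parent (ball_reach conn R0) (a x).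
    rewrite -{1}nx -px (inj_eq perm_inj); exact: next_neq_prev.
  by rewrite eqxx.
have lx0 : lv (a x) = 0 by apply/eqP; rewrite level_eq0.
have ap y : y \in p -> a y \in p.
  move=> yp; suff : a y \in R by rewrite inE.
  by rewrite -(level_eq0 (ball_reach conn R0)) -leqn0 -lx0; exact: xmax.
have psiE y z : y \in p -> z \in p -> psi y z = w' y z.
  by move=> yp zp; rewrite /psi /encoding !inE yp zp.
have wa y : y \in p -> w' (a y) (a (next p y)) = w y (next p y).
  move=> yp; rewrite -psiE ?ap ?mem_next // pres ?en // psiE ?mem_next //.
  by rewrite /w' eqxx.
have a_aut : cycle_aut p a.
  move=> y yp; split; first exact: ap.
  have := wa y yp; rewrite /w'; case: ifP => [/orP[/eqP ->|/eqP ->] _|_ w0].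
  - by left.
  - by right; rewrite prev_next.
  - by have := w_gt0 yp; rewrite -w0.
have afix : {in p, forall y, a y = y}.
  apply: rigid => // y yp; rewrite -wa // /w'.
  have [_ [->|->]] := a_aut y yp; first by rewrite eqxx.
  by rewrite next_prev // eqxx orbT.
split=> y; last by rewrite inE => /afix ->.
apply/idP/idP => [|yR]; rewrite !inE; last by rewrite ap // -[_ \in p]inE.
by move=> ayp; have := afix _ ayp => /perm_inj <-.
Qed.
End CycleRoot.

(** * Words that make a cycle rigid, for three or more labels *)

Definition same_edge (T : eqType) (x y u v : T) :=
  (x == u) && (y == v) || (x == v) && (y == u).

Lemma same_edgeC (T : eqType) (x y u v : T) : same_edge x y u v = same_edge y x u v.
Proof. by rewrite /same_edge orbC [(x == v) && _]andbC [(x == u) && _]andbC. Qed.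

Lemma same_edgeP (T : eqType) (x y u v : T) :
  reflect (x = u /\ y = v \/ x = v /\ y = u) (same_edge x y u v).
Proof.
by apply: (iffP orP) => [[/andP[/eqP -> /eqP ->]|/andP[/eqP -> /eqP ->]]|[[-> ->]|[-> ->]]];
  rewrite ?eqxx; [left|right|left|right].
Qed.

Lemma iter_next_eq (T : finType) (p : seq T) x i j : uniq p -> x \in p -> i < size p -> j < size p ->
  (iter i (next p) x == iter j (next p) x) = (i == j).
Proof.
move=> p_uniq xp ip jp; have ox := order_cycle (cycle_next p_uniq) p_uniq xp.
apply/eqP/eqP => [ij|-> //].
by rewrite -(@findex_iter _ (next p) x i) ?ox // ij findex_iter ?ox.
Qed.

Section MarkedCycle.
Variables (T : finType) (e : rel T) (p : seq T) (c : T -> nat) (r : nat).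
Hypotheses (e_sym : symmetric e) (conn : connected_graph e).
Hypotheses (p_uniq : uniq p) (p_size : 2 < size p) (p_cycle : path.cycle e p).
Hypotheses (cr : vlabeling r c) (dist : vdistinguishing e c).

(** There are three nonzero labels: 1 and 2 are spent on two consecutive edges and 3 on all the
    others. Both edges are then preserved, so their common vertex and its neighbours on them are
    fixed. *)
Lemma has_edist_gt3 : 3 < r -> has_edist e r.
Proof.
move=> r3; have [q0 q0p] : exists x, x \in p by case: p p_size => // x s _; exists x; rewrite mem_head.
set q1 := next p q0; set q2 := next p q1.
have q1p : q1 \in p by rewrite mem_next.
have q2p : q2 \in p by rewrite mem_next.
have qE i j : i < 3 -> j < 3 -> (iter i (next p) q0 == iter j (next p) q0) = (i == j).
  by move=> i3 j3; rewrite iter_next_eq // (leq_trans _ p_size).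
have q01 : q0 != q1 by rewrite (qE 0 1).
have q12 : q1 != q2 by rewrite (qE 1 2).
have q02 : q0 != q2 by rewrite (qE 0 2).
pose w x y := if same_edge x y q0 q1 then 1 else if same_edge x y q1 q2 then 2 else 3.
apply: (has_edist_of_cycle e_sym conn p_uniq p_size p_cycle cr dist (w := w)).
- by move=> x y; rewrite /w; case: ifP => _; first lia; case: ifP => _; lia.
- by move=> x y; rewrite /w !(same_edgeC x y).
- by move=> x _; rewrite /w; case: ifP => // _; case: ifP.
move=> a aut a_aut wa.
have := wa _ q0p; have := wa _ q1p; rewrite -/q2 -/q1 /w.
have s0 : same_edge q0 q1 q0 q1 by rewrite /same_edge !eqxx.
have s1 : same_edge q1 q2 q1 q2 by rewrite /same_edge !eqxx.
have s2 : same_edge q1 q2 q0 q1 = false.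
  by rewrite /same_edge (eq_sym q1 q0) (negPf q01) (eq_sym q2 q0) (negPf q02) andbF.
rewrite s0 s1 s2; case: ifP => // _; case: ifP => // /same_edgeP a12 _.
case: ifP => [/same_edgeP a01 _|_]; last by case: ifP.
move/eqP: q01 => q01; move/eqP: q02 => q02; move/eqP: q12 => q12.
apply: (cycle_aut_id p_uniq p_size (@perm_inj _ a) a_aut q1p).
  by case: a12 => -[h1 h2]; case: a01 => -[h3 h4]; congruence.
by rewrite -/q2; case: a12 => -[h1 h2]; case: a01 => -[h3 h4]; congruence.
Qed.

(* Of the edges of the cycle, only those between positions 0-1, 1-2 and 3-4 are
   labelled 1: position 1 is fixed, and the reflection about it would move the
   third edge to positions -1 and -2. *)
Lemma has_edist_long : 2 < r -> 5 < size p -> has_edist e r.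
Proof.
move=> r2 p5; have [x0 x0p] : exists x, x \in p by case: p p_size => // x s _; exists x; rewrite mem_head.
pose q i := iter i (next p) x0.
have qp i : q i \in p by elim: i => //= i IHi; rewrite mem_next.
have nq i : next p (q i) = q i.+1 by [].
have pq i : prev p (q i.+1) = q i by rewrite -nq prev_next.
have qE i j : i < 6 -> j < 6 -> (q i == q j) = (i == j).
  by move=> i3 j3; rewrite iter_next_eq // (leq_trans _ p5).
pose m x y := [|| same_edge x y (q 0) (q 1), same_edge x y (q 1) (q 2) | same_edge x y (q 3) (q 4)].
pose w x y := if m x y then 1 else 2.
apply: (has_edist_of_cycle e_sym conn p_uniq p_size p_cycle cr dist (w := w)).
- by move=> x y; rewrite /w; case: ifP => _; lia.
- by move=> x y; rewrite /w /m !(same_edgeC x y).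
- by move=> x _; rewrite /w; case: ifP.
move=> a aut a_aut wa.
have ma i : m (q i) (q i.+1) -> m (a (q i)) (a (q i.+1)).
  by move=> mi; have := wa _ (qp i); rewrite nq /w mi; case: ifP.
have e0 : m (a (q 0)) (a (q 1)) by apply: ma; rewrite /m /same_edge !eqxx.
have e1 : m (a (q 1)) (a (q 2)) by apply: ma; rewrite /m /same_edge !eqxx !orbT.
have e3 : m (a (q 3)) (a (q 4)) by apply: ma; rewrite /m /same_edge !eqxx !orbT.
have neq i j : i < 6 -> j < 6 -> i != j -> q i <> q j by move=> i6 j6 ij; apply/eqP; rewrite qE.
have n01 := neq 0 1 isT isT isT; have n02 := neq 0 2 isT isT isT; have n03 := neq 0 3 isT isT isT.
have n04 := neq 0 4 isT isT isT; have n12 := neq 1 2 isT isT isT; have n13 := neq 1 3 isT isT isT.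
have n14 := neq 1 4 isT isT isT; have n23 := neq 2 3 isT isT isT; have n24 := neq 2 4 isT isT isT.
have n34 := neq 3 4 isT isT isT.
have na02 : a (q 0) <> a (q 2) by move/perm_inj.
have mP x y : m x y -> (x = q 0 /\ y = q 1 \/ x = q 1 /\ y = q 0) \/
    (x = q 1 /\ y = q 2 \/ x = q 2 /\ y = q 1) \/ (x = q 3 /\ y = q 4 \/ x = q 4 /\ y = q 3).
  by case/or3P => /same_edgeP; [left|right; left|right; right].
have [aq1 aq02] : a (q 1) = q 1 /\ (a (q 2) = q 2 \/ a (q 2) = q 0).
  by move/mP: e0 => [[|]|[[|]|[|]]] [h1 h2]; move/mP: e1 => [[|]|[[|]|[|]]] [h3 h4];
    try congruence; split; try congruence; try (by left); try (by right).
apply: (cycle_aut_id p_uniq p_size (@perm_inj _ a) a_aut (qp 1)) => //.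
rewrite nq; case: aq02 => // aq2.
have := cycle_aut_prev p_uniq p_size (@perm_inj _ a) a_aut (qp 1).
rewrite nq aq2 aq1 pq => /(_ erefl) refl.
have aq3 : a (q 3) = prev p (q 0) by rewrite -nq refl // aq2.
(* Position -1 differs from the positions 0 to 4 because the cycle has at least six vertices. *)
have q05 i : i < 5 -> a (q 3) <> q i.
  move=> i5; rewrite aq3 => /(congr1 (next p)); rewrite next_prev // nq => /eqP.
  by rewrite qE.
by move/mP: e3 => [[|]|[[|]|[|]]] [h _]; case: (q05 _ _ h).
Qed.

(** Only one edge of the cycle is labelled 1, the others 2. The hypothesis on [u] rules out a
    reversal of this edge, so both its ends are fixed. It will be met by ends of different core
    degree. *)
Lemma has_edist_marked u : 2 < r -> u \in p ->
  (forall a : {perm T}, is_aut e a -> a u <> next p u) -> has_edist e r.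
Proof.
move=> r2 up nau.
pose w x y := if same_edge x y u (next p u) then 1 else 2.
apply: (has_edist_of_cycle e_sym conn p_uniq p_size p_cycle cr dist (w := w)).
- by move=> x y; rewrite /w; case: ifP => _; lia.
- by move=> x y; rewrite /w !(same_edgeC x y).
- by move=> x _; rewrite /w; case: ifP.
move=> a aut a_aut wa.
have := wa _ up; rewrite /w {2}/same_edge !eqxx; case: ifP => //.
move=> /same_edgeP[[au anu]|[/(nau _ aut)]] // _.
exact: (cycle_aut_id p_uniq p_size (@perm_inj _ a) a_aut up).
Qed.
End MarkedCycle.
(* Along an edge the change of label modulo 3 under an automorphism preserving
   [c x + c y] is negated, so around an odd cycle it equals its own negative. *)
Lemma has_edist_odd_cycle (T : finType) (e : rel T) (p : seq T) (c : T -> nat) :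
  symmetric e -> connected_graph e -> odd (size p) -> path.cycle e p ->
  vlabeling 3 c -> vdistinguishing e c -> has_edist e 3.
Proof.
move=> e_sym conn p_odd p_cycle cr dist.
exists (fun x y => (c x + c y) %% 3); split=> [x y _|a aut pres].
  by rewrite ltn_mod addnC.
(* Modulo 3, [2 * c x] is the negative of [c x]: thus [d] is the change of label, written without
   truncated subtraction. *)
apply: dist => // x; pose d x := (c (a x) + 2 * c x) %% 3.
have dP y q : path e y q -> d (last y q) = if odd (size q) then (3 - d y) %% 3 else d y.
  elim: q y => [|z q IHq] y //= /andP[eyz /IHq ->].
  have := pres _ _ eyz; rewrite /d.
  by case: (odd _) => /=; have := cr y; have := cr z; have := cr (a y); have := cr (a z); lia.
suff dx : d x = 0 by have := cr x; have := cr (a x); rewrite /d in dx; lia.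
case: p p_odd p_cycle => // y q p_odd /dP; rewrite last_rcons size_rcons p_odd => dy.
have {}dy : d y = 0 by move: dy (ltn_pmod (c (a y) + 2 * c y) (isT : 0 < 3));
  rewrite -/(d y); move: (d y) => k; lia.
have /connectP[s /dP + ->] := conn y x; by rewrite dy => ->; case: ifP.
Qed.

(** * The core: invariance, connectedness and cycles *)

Section Core.
Variables (T : finType) (e : rel T).

Definition degree_in (X : {set T}) x := #|[set y in X | e x y]|.

Definition min_degree2 (X : {set T}) := [forall x in X, 1 < degree_in X x].

(** This is the 2-core. As a union of all candidates, rather than the result of deleting leaves, it
    is visibly invariant under automorphisms. *)
Definition core : {set T} := \bigcup_(X : {set T} | min_degree2 X) X.

Lemma degree_inS (X Y : {set T}) x : X \subset Y -> degree_in X x <= degree_in Y x.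
Proof.
move=> /subsetP XY; apply/subset_leq_card/subsetP => y; rewrite !inE.
by case/andP=> /XY -> ->.
Qed.

Lemma min_degree2_core X : min_degree2 X -> X \subset core.
Proof. by move=> X2; apply: bigcup_sup. Qed.

Lemma core_degree x : x \in core -> 1 < degree_in core x.
Proof.
case/bigcupP=> X X2 xX; apply: leq_trans (degree_inS _ (min_degree2_core X2)).
by move/forallP: X2 => /(_ x)/implyP; apply.
Qed.

Lemma degree_in_imset (a : {perm T}) (X : {set T}) x : is_aut e a ->
  degree_in (a @: X) (a x) = degree_in X x.
Proof.
move=> aut; rewrite /degree_in -[RHS](card_imset _ (@perm_inj _ a)); congr #|pred_of_set _|.
apply/setP => y; rewrite -(permKV a y) !inE !(mem_imset _ _ (@perm_inj _ a)) !inE.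
by rewrite aut.
Qed.

Lemma core_aut (a : {perm T}) : is_aut e a -> forall x, (a x \in core) = (x \in core).
Proof.
have core_im (b : {perm T}) x : is_aut e b -> x \in core -> b x \in core.
  move=> aut /bigcupP[X X2 xX]; apply/bigcupP; exists (b @: X); last exact: imset_f.
  apply/forallP => y; apply/implyP => /imsetP[z zX ->]; rewrite degree_in_imset //.
  by move/forallP: X2 => /(_ z)/implyP; apply.
move=> aut x; apply/idP/idP => [|/core_im]; last exact.
by move/(core_im _ _ (is_autV aut)); rewrite permK.
Qed.

Lemma core_degree_aut (a : {perm T}) : is_aut e a ->
  forall x, degree_in core (a x) = degree_in core x.
Proof.
move=> aut x; rewrite -[RHS](degree_in_imset _ _ aut); congr degree_in.
apply/setP => y; rewrite -(permKV a y) core_aut // mem_imset //; exact: perm_inj.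
Qed.

Hypotheses (e_sym : symmetric e) (e_irr : irreflexive e).

Lemma cycle_degree (p : seq T) (X : {set T}) x : uniq p -> 2 < size p -> path.cycle e p ->
  {subset p <= X} -> x \in p -> [set next p x; prev p x] \subset [set y in X | e x y].
Proof.
move=> p_uniq p_size p_cycle pX xp; apply/subsetP => y; rewrite !inE.
case/orP=> /eqP ->; first by rewrite pX ?mem_next // next_cycle.
by rewrite pX ?mem_prev // e_sym prev_cycle.
Qed.

Lemma card_next_prev (p : seq T) x : uniq p -> 2 < size p -> x \in p ->
  #|[set next p x; prev p x]| = 2.
Proof. by move=> *; rewrite cards2 next_neq_prev. Qed.

Lemma cycle_core (p : seq T) : uniq p -> 2 < size p -> path.cycle e p -> {subset p <= core}.
Proof.
move=> p_uniq p_size p_cycle x xp.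
suff /min_degree2_core/subsetP/(_ x) : min_degree2 [set y in p] by rewrite inE; apply.
apply/forallP => y; apply/implyP; rewrite inE => yp.
have pX : {subset p <= [set z in p]} by move=> z; rewrite inE.
have := subset_leq_card (cycle_degree p_uniq p_size p_cycle pX yp).
by rewrite card_next_prev.
Qed.

Definition core_rel x y := [&& x \in core, y \in core & e x y].

(** Each inner vertex of a simple path between two core vertices has two neighbours on the path.
    Adding the path to the core thus keeps the minimum degree at 2, and maximality puts the path
    inside the core. *)
Lemma core_connect : connected_graph e -> {in core &, forall x y, connect core_rel x y}.
Proof.
move=> conn x y xC yC; have /connectP[q0 q0p lst] := conn x y.
have {q0 q0p lst} [q [qp q_uniq lst]] : exists q, [/\ path e x q, uniq (x :: q) & y = last x q].
  by rewrite lst; case/shortenP: q0p => q ? ? _; exists q.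
pose X := core :|: [set z in q].
have xqX : {subset x :: q <= X}.
  by move=> z; rewrite !inE => /orP[/eqP ->|->]; rewrite ?xC ?orbT.
have /min_degree2_core/subsetP XC : min_degree2 X.
  apply/forallP => z; apply/implyP => zX.
  have [zC|zC] := boolP (z \in core).
    by apply: leq_trans (core_degree zC) (degree_inS _ _); rewrite subsetUl.
  have zq : z \in q by move: zX; rewrite !inE (negPf zC).
  case/splitPr: zq qp q_uniq lst xqX => q1 [|u q2].
    by move=> _ _; rewrite last_cat /= => zy; rewrite -zy yC in zC.
  rewrite cat_path /= => /and4P[_ e1 e2 _] q_uniq _ xqX.
  have uX : u \in X by apply: xqX; rewrite inE mem_cat !inE eqxx !orbT.
  have lX : last x q1 \in X.
    by apply: xqX; rewrite -cat_cons mem_cat mem_last.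
  have lu : last x q1 != u.
    move: q_uniq; rewrite -[_ && _]/(uniq (x :: q1 ++ [:: z, u & q2])) -cat_cons cat_uniq.
    case/and3P=> _ /hasPn h _.
    apply: contraTneq (mem_last x q1) => ->; apply: h; by rewrite !inE eqxx orbT.
  have <- : #|[set last x q1; u]| = 2 by rewrite cards2 lu.
  apply/subset_leq_card/subsetP => v; rewrite !inE => /orP[]/eqP ->.
    by move: lX; rewrite !inE e_sym e1 => ->.
  by move: uX; rewrite !inE e2 => ->.
have {}xqX : {subset x :: q <= core} by move=> z /xqX /XC.
apply/connectP; exists q => // {lst q_uniq yC}.
elim: q x xC qp xqX {X XC} => //= u q IHq x xC /andP[exu uq] xqX.
have uC : u \in core by apply: xqX; rewrite !inE eqxx orbT.
rewrite {1}/core_rel xC uC exu IHq // => z zq; apply: xqX; by rewrite inE zq orbT.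
Qed.

(** A path is extended at its front while possible; [n] bounds the number of vertices of [W] still
    off the path. *)
Lemma maximal_path (W : {set T}) x0 : x0 \in W ->
  exists x s, [/\ path e x s, uniq (x :: s), {subset x :: s <= W}
                & {in W, forall y, e x y -> y \in s}].
Proof.
move=> x0W.
suff H n x s : path e x s -> uniq (x :: s) -> {subset x :: s <= W} -> #|W| - size (x :: s) <= n ->
    exists x s, [/\ path e x s, uniq (x :: s), {subset x :: s <= W}
                  & {in W, forall y, e x y -> y \in s}].
  by apply: (H _ x0 [::]) (leqnn _) => // y; rewrite inE => /eqP ->.
elim: n x s => [|n IHn] x s xs us sW n_le.
  exists x, s; split=> // y yW exy; apply/negPn/negP => ys.
  have ysu : uniq [:: y, x & s].
    by rewrite cons_uniq us andbT inE negb_or ys andbT; apply: contraTneq exy => ->; rewrite e_irr.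
  have : #|[:: y, x & s]| <= #|W|.
    by apply/subset_leq_card/subsetP => z; rewrite inE => /orP[/eqP ->|/sW].
  by rewrite (card_uniqP ysu) /=; move: n_le => /=; lia.
have [/existsP[y /and3P[yW exy ys]]|/existsPn none] := boolP [exists y, [&& y \in W, e x y & y \notin s]].
  apply: (IHn y (x :: s)) => /=.
  - by rewrite e_sym exy.
  - rewrite -[_ && _]/(uniq [:: y, x & s]) cons_uniq us andbT inE negb_or ys andbT.
    by apply: contraTneq exy => ->; rewrite e_irr.
  - by move=> z; rewrite inE => /orP[/eqP ->|/sW].
  - by move: n_le => /=; lia.
exists x, s; split=> // y yW exy; apply/negPn/negP => ys.
by have := none y; rewrite yW exy ys.
Qed.

(** The front of a maximal path has two neighbours, both on the path; the one that is not the next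
    vertex closes a cycle. *)
Lemma min_degree2_cycle (W : {set T}) : W != set0 -> min_degree2 W ->
  exists p, [/\ 2 < size p, uniq p, path.cycle e p & {subset p <= W}].
Proof.
case/set0Pn => x0 /maximal_path[x [s [xs us sW xmax]]] /forallP/(_ x)/implyP.
rewrite sW ?mem_head // => /(_ isT) /card_gt1P[y1 [y2 []]].
rewrite !inE => /andP[y1W e1] /andP[y2W e2] y12.
have [y [yW exy yh]] : exists y, [/\ y \in W, e x y & y != head x s].
  have [y1h|] := eqVneq y1 (head x s); last by exists y1.
  by exists y2; rewrite -y1h eq_sym.
have ys := xmax _ yW exy; case/splitPr: ys xs us sW yh {xmax} => s1 s2 xs us sW yh.
move: xs; rewrite cat_path /= => /and3P[xs1 ey _].
exists (x :: rcons s1 y); split.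
- by case: s1 yh {xs1 ey us sW} => [|z s1] /=; rewrite ?eqxx // size_rcons.
- by move: us; rewrite -cat_rcons -cat_cons cat_uniq => /andP[].
- by rewrite /= rcons_path rcons_path xs1 ey last_rcons e_sym.
- by move=> z zs; apply: sW; rewrite -cat_rcons -cat_cons mem_cat zs.
Qed.
End Core.

(** * Graphs whose core is a cycle *)

Section CoreCycle.
Variables (T : finType) (e : rel T) (p : seq T).
Hypotheses (e_sym : symmetric e) (conn : connected_graph e).
Hypotheses (p_uniq : uniq p) (p_size : 2 < size p) (p_cycle : path.cycle e p).

Let pC : {subset p <= core e} := cycle_core e_sym p_uniq p_size p_cycle.

Lemma core_nbr_cycle x y : x \in p -> degree_in e (core e) x <= 2 ->
  y \in core e -> e x y -> y = next p x \/ y = prev p x.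
Proof.
move=> xp x2 yC exy; have sub := cycle_degree e_sym p_uniq p_size p_cycle pC xp.
have : y \in [set y in core e | e x y] by rewrite inE yC.
have /eqP <- : [set next p x; prev p x] == [set y in core e | e x y].
  by rewrite eqEcard sub card_next_prev.
by rewrite !inE => /orP[]/eqP; [left|right].
Qed.

(** The two cycle neighbours exhaust the core neighbours of each vertex of [p], so a walk in the
    connected core cannot leave [p]. *)
Lemma core_eq_cycle : {in p, forall x, degree_in e (core e) x <= 2} -> {subset core e <= p}.
Proof.
move=> deg2 y yC; have [x0 x0p] : exists x, x \in p by case: p p_size => // x s _; exists x; rewrite mem_head.
have /connectP[s] := core_connect e_sym conn (pC x0p) yC.
elim: s x0 x0p => [|z s IHs] x xp /=; first by move=> _ ->.
move=> /andP[/and3P[xC zC exz] zs] ys; apply: IHs zs ys.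
by case: (core_nbr_cycle xp (deg2 _ xp) zC exz) => ->; rewrite (mem_next, mem_prev).
Qed.

Hypothesis deg2 : {in p, forall x, degree_in e (core e) x <= 2}.
Variables (c : T -> nat) (r : nat).
Hypotheses (cr : vlabeling r c) (dist : vdistinguishing e c) (r1 : 1 < r).

Let coreE : core e =i p.
Proof. by move=> x; apply/idP/idP => [/(core_eq_cycle deg2)|/pC]. Qed.

Lemma core_aut_cycle (a : {perm T}) : is_aut e a -> cycle_aut p a.
Proof.
move=> aut x xp; have axp : a x \in p by rewrite -coreE core_aut ?coreE.
split=> //; apply: core_nbr_cycle => //; first exact: deg2.
  by rewrite core_aut // coreE mem_next.
by rewrite aut next_cycle.
Qed.

Lemma has_edist_of_core_cycle (w : T -> T -> nat) :
    (forall x y, w x y < r) -> (forall x y, w x y = w y x) ->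
    (forall a : {perm T}, cycle_aut p a ->
       {in p, forall x, w (a x) (a (next p x)) = w x (next p x)} ->
       {in p, forall x, c (a x) = c x}) ->
  has_edist e r.
Proof.
move=> wr wC rigid.
have C0 : core e != set0.
  by apply/set0Pn; case: p p_size pC => // x s _ sub; exists x; rewrite sub ?mem_head.
apply: (has_edist_of_encoding (reach := ball_reach conn C0) e_sym cr dist _ wr wC); first exact: ltnW.
move=> a aut pres; split; first exact: core_aut.
move=> x; rewrite coreE; apply: rigid x; first exact: core_aut_cycle.
move=> x xp; apply: (encoding_root pres (core_aut aut)); last exact: next_cycle.
  by rewrite coreE.
by rewrite coreE mem_next.
Qed.

Definition reflects (rho : T -> T) :=
  [forall x in p, [&& rho x \in p, rho (next p x) == prev p (rho x) & c (rho x) == c x]].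

(** A reflection sends position [i] to [k - i] for some [k]. At half of [k] it fixes a vertex or
    moves it to its successor, according to the parity of [k]. *)
Lemma reflects_axis rho : reflects rho ->
  exists2 v, v \in p & rho v = v \/ rho v = next p v.
Proof.
move=> /forallP rhoP.
have [x0 x0p] : exists x, x \in p by case: p p_size => // x s _; exists x; rewrite mem_head.
pose q i := iter i (next p) x0.
have qp i : q i \in p by elim: i => //= i IHi; rewrite mem_next.
have rp := rhoP x0; rewrite x0p /= in rp; case/and3P: rp => r0p _ _.
have : fconnect (next p) x0 (rho x0) by rewrite (fconnect_cycle (cycle_next p_uniq)).
move/iter_findex; move: (findex _ _ _) => k kE.
have rhoq i : i <= k -> rho (q i) = q (k - i).
  elim: i => [|i IHi] ik; first by rewrite subn0 /q kE.
  have := rhoP (q i); rewrite qp /= => /and3P[_ /eqP + _].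
  rewrite -/(q i.+1) => ->; rewrite IHi ?(ltnW ik) //.
  by rewrite -(prev_next p_uniq (q (k - i.+1))) -[next p _]/(q (k - i.+1).+1) subnSK.
exists (q k./2) => //; rewrite rhoq; last by lia.
have [->|->] : k - k./2 = k./2 \/ k - k./2 = (k./2).+1 by lia.
  by left.
by right.
Qed.

Lemma reflects_agree rho (a : {perm T}) v : reflects rho -> cycle_aut p a -> v \in p ->
  a v = rho v -> a (next p v) = prev p (a v) -> {in p, forall x, c (a x) = c x}.
Proof.
move=> /forallP rhoP a_aut vp av anv.
have refl := cycle_aut_prev p_uniq p_size (@perm_inj _ a) a_aut vp anv.
have rP x : x \in p -> [/\ rho (next p x) = prev p (rho x) & c (rho x) = c x].
  by move=> xp; have := rhoP x; rewrite xp => /and3P[_ /eqP ? /eqP ?].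
have agree : {in p, forall x, a x = rho x}.
  apply: (cycle_ind p_uniq vp av) => x xp ax.
  by rewrite refl // ax; have [->] := rP _ xp.
by move=> x xp; rewrite agree //; have [] := rP _ xp.
Qed.

(** If a reflection preserves [c] on the cycle, it suffices to mark its axis by the label 1: only
    the identity and this reflection respect the mark, and both preserve [c]. If there is none, each
    edge takes the label of its first end: a rotation preserving these labels preserves [c], and a
    reflection would contradict the assumption. *)
Lemma has_edist_core_cycle : has_edist e r.
Proof.
have [/existsP[rho rhoP]|/existsPn no_refl] := boolP [exists rho : {ffun T -> T}, reflects rho].
  have [v vp rv] := reflects_axis rhoP.
  have nvp : next p v \in p by rewrite mem_next.
  have pvp : prev p v \in p by rewrite mem_prev.
  have vnv : v <> next p v.
    move=> vnv; have := next2_neq p_uniq p_size vp.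
    by rewrite -!vnv eqxx.
  have vpv : v <> prev p v by move=> vpv; apply: vnv; rewrite {2}vpv next_prev.
  have npv : next p v <> prev p v by apply/eqP; exact: next_neq_prev.
  have id_c (a : {perm T}) : cycle_aut p a -> a v = v -> a (next p v) = next p v ->
      {in p, forall x, c (a x) = c x}.
    move=> a_aut av anv x xp.
    by rewrite (cycle_aut_id p_uniq p_size (@perm_inj _ a) a_aut vp av anv).
  case: rv => rv.
    pose w x y := nat_of_bool (same_edge x y v (next p v) || same_edge x y v (prev p v)).
    apply: (has_edist_of_core_cycle (w := w)).
    - by move=> x y; rewrite /w; case: (_ || _); lia.
    - by move=> x y; rewrite /w !(same_edgeC x y).
    move=> a a_aut wa.
    have en : w (a v) (a (next p v)) = 1 by rewrite wa // /w /same_edge !eqxx.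
    have ep : w (a (prev p v)) (a v) = 1.
      by rewrite -{2}(next_prev p_uniq v) wa // next_prev // /w /same_edge !eqxx !orbT.
    have anp : a (next p v) <> a (prev p v) by move/perm_inj.
    have wP x y : w x y = 1 -> (x = v /\ y = next p v \/ x = next p v /\ y = v) \/
        (x = v /\ y = prev p v \/ x = prev p v /\ y = v).
      by rewrite /w; case: orP => // -[] /same_edgeP; [left|right].
    have av : a v = v.
      by case: (wP _ _ en) => [[]|[]] [h1 h2]; case: (wP _ _ ep) => [[]|[]] [h3 h4]; congruence.
    have [_ [|]] := a_aut _ vp; rewrite av; first exact: id_c.
    by move=> anv; apply: (reflects_agree rhoP a_aut vp); rewrite ?av.
  pose w x y := nat_of_bool (same_edge x y v (next p v)).
  apply: (has_edist_of_core_cycle (w := w)).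
  - by move=> x y; rewrite /w; case: same_edge; lia.
  - by move=> x y; rewrite /w !(same_edgeC x y).
  move=> a a_aut wa.
  have : w (a v) (a (next p v)) = 1 by rewrite wa // /w /same_edge !eqxx.
  rewrite /w; case: same_edgeP => // -[[av anv]|[av anv]] _; first exact: id_c.
  by apply: (reflects_agree rhoP a_aut vp); rewrite av // anv prev_next.
pose w x y := if y == next p x then c x else if x == next p y then c y else 0.
have wC x y : w x y = w y x.
  rewrite /w; case: eqVneq => [yx|_]; case: eqVneq => [xy|_] //.
  have [xp|xp] := boolP (x \in p).
    by have := next2_neq p_uniq p_size xp; rewrite -yx -xy eqxx.
  by rewrite yx next_nth (negPf xp).
have wn x : w x (next p x) = c x by rewrite /w eqxx.
apply: (has_edist_of_core_cycle (w := w)) => //.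
  by move=> x y; rewrite /w; do 2?case: ifP => _ //; lia.
move=> a a_aut wa.
have [x0 x0p] : exists x, x \in p by case: p p_size => // x s _; exists x; rewrite mem_head.
have [_ [rot|refl]] := a_aut _ x0p.
  have {}rot := cycle_aut_next p_uniq p_size (@perm_inj _ a) a_aut x0p rot.
  by move=> x xp; rewrite -wn -rot // wa.
have {}refl := cycle_aut_prev p_uniq p_size (@perm_inj _ a) a_aut x0p refl.
(* The reflection [a] sends the edge after [x] to the edge before [a x], whose label is that of
   [prev p (a x)]. Hence composing with [prev p] gives a reflection that preserves [c]. *)
case/negP: (no_refl [ffun x => prev p (a x)]); apply/forallP => x; apply/implyP => xp.
rewrite !ffunE mem_prev (a_aut _ xp).1 refl // eqxx /=.
by rewrite -wn next_prev // wC -refl // wa // wn.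
Qed.
End CoreCycle.

(** * The case of at least three labels *)

(** With three labels, the earlier constructions leave only graphs whose cycles all have length 4.
    The front of a maximal path in the core then lies on such a cycle and has core degree 2. Either
    the cycle is the whole core, or its core degree rises above 2 at some step, and that edge can be
    marked. *)
Lemma has_edist_ge3 (T : finType) (e : rel T) (c : T -> nat) r :
    symmetric e -> irreflexive e -> connected_graph e -> has_cycle e ->
    vlabeling r c -> vdistinguishing e c -> 2 < r -> has_edist e r.
Proof.
move=> e_sym e_irr conn [p [p_size p_uniq p_cycle]] cr dist r2.
have [r3|r3] := ltnP 3 r; first exact: has_edist_gt3 e_sym conn p_uniq p_size p_cycle cr dist r3.
have {r2 r3} r3 : r = 3 by lia.
subst r; have [yes|no] := boolP (Defs.decP (has_edist e 3)); first exact: Defs.decPP.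
have {no} size4 q : uniq q -> 2 < size q -> path.cycle e q -> size q = 4.
  move=> q_uniq q_size q_cycle.
  have [|q5] := ltnP 5 (size q).
    move=> q5; case/negP: no; apply: decPI.
    exact: has_edist_long e_sym conn q_uniq q_size q_cycle cr dist _ _.
  have [|q_odd] := boolP (odd (size q)).
    move=> q_odd; case/negP: no; apply: decPI.
    exact: has_edist_odd_cycle e_sym conn q_odd q_cycle cr dist.
  by move: q_odd q_size q5; case: (size q) => [|[|[|[|[|[|n]]]]]].
have [x0 x0p] : exists x, x \in p by case: p p_size {p_uniq p_cycle} => // x s _; exists x; rewrite mem_head.
have x0C : x0 \in core e by exact: cycle_core p_size p_cycle _ _.
have [x [s [xs us sC xmax]]] := maximal_path e_sym e_irr x0C.
pose q := x :: take 3 s.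
(* A neighbour of [x] at position [i > 0] of [s] closes a cycle of length [i + 2], which forces
   [i = 2]. *)
have nbrP y : y \in core e -> e x y ->
    y = nth x s 0 \/ [/\ y = nth x s 2, uniq q, size q = 4 & path.cycle e q].
  move=> yC exy; have ys := xmax y yC exy; rewrite /q.
  case/splitPr: ys xs us {sC xmax} => -[|z s1] s2 xs us; [by left|right].
  have q_uniq : uniq (x :: rcons (z :: s1) y).
    by move: us; rewrite -cat_rcons -cat_cons cat_uniq => /andP[].
  have q_cycle : path.cycle e (x :: rcons (z :: s1) y).
    rewrite /path.cycle rcons_path last_rcons e_sym exy andbT.
    by move: xs; rewrite -cat_rcons cat_path => /andP[].
  have q_size : 2 < size (x :: rcons (z :: s1) y) by rewrite /= size_rcons.
  have q4 := size4 _ q_uniq q_size q_cycle.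
  case: s1 q4 q_uniq q_cycle {xs us q_size} => [|u [|]]; rewrite //= ?size_rcons //.
    by rewrite take0.
  by move=> a l; rewrite size_rcons.
have q_or : [/\ uniq q, size q = 4 & path.cycle e q].
  have /card_gt1P[y1 [y2 []]] := core_degree (sC x (mem_head _ _)).
  rewrite !inE => /andP[y1C e1] /andP[y2C e2] /eqP y12.
  have [y1h|[_ ? ? ?] //] := nbrP _ y1C e1; have [y2h|[_ ? ? ?] //] := nbrP _ y2C e2.
  by case: y12; rewrite y1h.
case: q_or => q_uniq q4 q_cycle; have q_size : 2 < size q by rewrite q4.
have xq : x \in q by rewrite mem_head.
have x2 : degree_in e (core e) x <= 2.
  apply: leq_trans (_ : #|[set nth x s 0; nth x s 2]| <= 2); last by rewrite cards2; case: (_ != _).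
  apply/subset_leq_card/subsetP => y; rewrite !inE => /andP[yC exy].
  by case: (nbrP _ yC exy) => [->|[-> _ _ _]]; rewrite eqxx ?orbT.
have [all2|/allPn[z zq z2]] := boolP (all (fun z => degree_in e (core e) z <= 2) q).
  by apply: (has_edist_core_cycle e_sym conn q_uniq q_size q_cycle (allP all2) cr dist).
have [/hasP[u uq /andP[u2 nu2]]|/hasPn no_step] :=
    boolP (has (fun u => (degree_in e (core e) u <= 2) && ~~ (degree_in e (core e) (next q u) <= 2)) q).
  apply: (has_edist_marked e_sym conn q_uniq q_size q_cycle cr dist isT uq) => a aut aunu.
  by move: nu2; rewrite -aunu core_degree_aut // u2.
case/negP: z2; apply: (@cycle_ind _ q q_uniq (fun z => degree_in e (core e) z <= 2) x xq x2 _ z zq) => u uq u2.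
by have := no_step u uq; rewrite u2 negbK.
Qed.

(** * Cuts of at most two edges in the core *)

Section Cuts.
Variables (T : finType) (e : rel T).
Hypotheses (e_sym : symmetric e) (e_irr : irreflexive e) (conn : connected_graph e).

Definition boundary (X : {set T}) : {set T * T} :=
  [set q | [&& q.1 \in X, q.2 \in core e :\: X & e q.1 q.2]].

Definition acyclic (X : {set T}) :=
  ~ exists p, [/\ 2 < size p, uniq p, path.cycle e p & {subset p <= X}].

(** A nonempty forest has fewer edges than vertices; the induction deletes a vertex of degree at
    most 1. *)
Lemma sum_degree_acyclic (X : {set T}) : X != set0 -> acyclic X ->
  \sum_(x in X) degree_in e X x + 2 <= 2 * #|X|.
Proof.
elim: {X}_.+1 {-2}X (ltnSn #|X|) => // n IHn X Xn X0 Xa.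
have /forallPn[x] : ~~ min_degree2 e X by apply/negP => /(min_degree2_cycle e_sym e_irr X0).
rewrite negb_imply -leqNgt => /andP[xX dx].
have cX : #|X| = #|X :\ x|.+1 by rewrite (cardsD1 x) xX.
have xE : degree_in e X x = \sum_(y in X :\ x) e x y.
  rewrite /degree_in -sum1_card big_mkcond [RHS]big_mkcond; apply: eq_bigr => y _.
  by rewrite !inE; case: eqVneq => [->|_]; rewrite ?e_irr ?andbF //=; case: (_ \in _); case: (e _ _).
have dE y : y \in X :\ x -> degree_in e X y = degree_in e (X :\ x) y + e x y.
  move=> _; rewrite /degree_in (cardsD1 x) inE xX e_sym addnC; congr (_ + _).
  by apply: eq_card => z; rewrite !inE andbA.
rewrite (big_setD1 x xX) /= (eq_bigr _ dE) big_split /= -xE.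
have [Y0|Y0] := eqVneq (X :\ x) set0.
  rewrite xE Y0 !big_set0; lia.
have := IHn (X :\ x); rewrite cX ltnS in Xn => /(_ Xn Y0) H.
suff /H : acyclic (X :\ x) by lia.
move=> [p [? ? ? pX]]; apply: Xa; exists p; split=> // z /pX.
by rewrite inE => /andP[].
Qed.

Lemma sum_degree_core (X : {set T}) : X \subset core e ->
  \sum_(x in X) degree_in e (core e) x = \sum_(x in X) degree_in e X x + #|boundary X|.
Proof.
move=> /subsetP XC.
have -> : #|boundary X| = \sum_(x in X) #|[set y in core e :\: X | e x y]|.
  under eq_bigr => x _ do rewrite -sum1_card.
  rewrite pair_big_dep -sum1_card; apply: eq_bigl => -[x y].
  by rewrite !inE.
rewrite -big_split /=; apply: eq_bigr => x xX.
rewrite /degree_in -(cardsID X [set y in core e | e x y]).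
by congr (_ + _); apply: eq_card => y; rewrite !inE;
  case: (boolP (y \in X)) => [/XC ->|]; rewrite ?andbT ?andbF.
Qed.

Lemma acyclic_boundary (X : {set T}) : X != set0 -> X \subset core e -> acyclic X ->
  \sum_(x in X) degree_in e (core e) x + 2 <= 2 * #|X| + #|boundary X|.
Proof. by move=> X0 XC Xa; rewrite sum_degree_core //; have := sum_degree_acyclic X0 Xa; lia. Qed.

(** The core degrees on [X] are at least 2, while the forest bound and the two boundary edges allow
    a sum of at most twice the cardinality of [X]. So an acyclic side of such a cut consists of
    vertices of degree 2. *)
Lemma acyclic_degree (X : {set T}) x : X \subset core e -> acyclic X ->
  #|boundary X| <= 2 -> x \in X -> degree_in e (core e) x = 2.
Proof.
move=> XC Xa bX xX; have X0 : X != set0 by apply/set0Pn; exists x.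
have := acyclic_boundary X0 XC Xa; rewrite (big_setD1 x xX) /= (cardsD1 x) xX.
have : \sum_(y in X :\ x) 2 <= \sum_(y in X :\ x) degree_in e (core e) y.
  by apply: leq_sum => y; rewrite inE => /andP[_ yX]; apply/core_degree/(subsetP XC).
have := core_degree (subsetP XC _ xX); rewrite sum_nat_const /=; move: bX.
move: (degree_in _ _ _) (\sum_(_ in _) _) #|_ :\ _| #|boundary _| => d s n b; lia.
Qed.

Lemma acyclic_boundary2 (X : {set T}) : X != set0 -> X \subset core e -> acyclic X ->
  1 < #|boundary X|.
Proof.
move=> X0 XC Xa; have := acyclic_boundary X0 XC Xa.
have : \sum_(y in X) 2 <= \sum_(y in X) degree_in e (core e) y.
  by apply: leq_sum => y yX; apply/core_degree/(subsetP XC).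
rewrite sum_nat_const; lia.
Qed.

Lemma core_crossing (X : {set T}) x y : x \in core e -> y \in core e -> x \in X -> y \notin X ->
  exists z t, [/\ z \in core e, t \in core e, e z t, z \in X & t \notin X].
Proof.
move=> xC yC xX yX; have /connectP[s] := core_connect e_sym conn xC yC.
elim: s x xC xX => [|t s IHs] x xC xX /=; first by move=> _ yx; rewrite yx xX in yX.
move=> /andP[/and3P[_ tC ext] ts] ys; have [tX|tX] := boolP (t \in X); first exact: IHs ts ys.
by exists x, t.
Qed.

(** The edges [g] and [h] only bound the edges leaving [X] inside the core: they may coincide and
    need not cross, so [cut2 X g g] allows at most one edge. *)
Definition cut2 (X : {set T}) (g h : T * T) :=
  forall x y, x \in core e -> y \in core e -> e x y -> x \in X -> y \notin X ->
    same_edge x y g.1 g.2 || same_edge x y h.1 h.2.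

Definition nonbridge (g : T * T) :=
  forall X : {set T}, cut2 X g g -> (g.1 \in X) = (g.2 \in X).

Lemma cut2_boundary (X : {set T}) g h : X \subset core e -> cut2 X g h -> #|boundary X| <= 2.
Proof.
move=> /subsetP XC cX.
pose i (q : T * T) := if q.1 \in X then q else (q.2, q.1).
apply: leq_trans (_ : #|[set i g; i h]| <= 2); last by rewrite cards2; case: (_ != _).
apply/subset_leq_card/subsetP => -[x y]; rewrite !inE /= => /and3P[xX /andP[yX yC] exy].
have key (q : T * T) : same_edge x y q.1 q.2 -> (x, y) == i q.
  by case: q => q1 q2 /same_edgeP /= [[<- <-]|[<- <-]]; rewrite /i /= ?xX ?(negPf yX).
by have /orP[/key ->|/key ->] := cX x y (XC _ xX) yC exy xX yX; rewrite ?orbT.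
Qed.

Lemma cut2C (X : {set T}) g h : cut2 X g h -> cut2 (core e :\: X) g h.
Proof.
move=> cX x y xC yC exy; rewrite !inE xC yC !andbT negbK => xX yX.
by rewrite !(same_edgeC x y); apply: cX; rewrite // e_sym.
Qed.

(** Without the edge after [u] the cycle is a path joining the two ends of that edge, which must
    cross as well. *)
Lemma cycle_crossing (p : seq T) (X : {set T}) u : uniq p -> u \in p ->
  (u \in X) != (next p u \in X) ->
  exists y, [/\ y \in p, y != u & (y \in X) != (next p y \in X)].
Proof.
move=> p_uniq up uX.
have [/hasP[y yp /andP[yu yX]]|/hasPn none] :=
    boolP (has (fun y => (y != u) && ((y \in X) != (next p y \in X))) p); first by exists y.
case/negP: uX; apply/eqP; pose P z := (z \in X) = (next p u \in X).
have nup : next p u \in p by rewrite mem_next.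
apply: (@cycle_ind _ p p_uniq P (next p u) nup (erefl _) _ u up) => z zp Pz.
rewrite /P; have [-> //|zu] := eqVneq z u.
by have := none z zp; rewrite zu /= negbK => /eqP <-.
Qed.

Section OnCycle.
Variable p : seq T.
Hypotheses (p_uniq : uniq p) (p_size : 2 < size p) (p_cycle : path.cycle e p).

Let pC : {subset p <= core e} := cycle_core e_sym p_uniq p_size p_cycle.

Lemma cycle_crossing_edge (X : {set T}) g h y : cut2 X g h -> y \in p ->
  (y \in X) != (next p y \in X) ->
  same_edge y (next p y) g.1 g.2 || same_edge y (next p y) h.1 h.2.
Proof.
move=> cX yp; have yC := pC yp; have nyC : next p y \in core e by rewrite pC ?mem_next.
have ey := next_cycle p_cycle yp.
have [yX|yX] := boolP (y \in X); have [nyX|nyX] := boolP (next p y \in X) => // _.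
  exact: cX.
by rewrite !(same_edgeC y); apply: cX; rewrite // e_sym.
Qed.

Lemma same_edge_next u y : u \in p -> same_edge y (next p y) u (next p u) -> y = u.
Proof.
move=> up /same_edgeP[[] //|[yu nyu]].
by have := next2_neq p_uniq p_size up; rewrite -yu nyu eqxx.
Qed.

Lemma nonbridge_cycle u : u \in p -> nonbridge (u, next p u).
Proof.
move=> up X cX; apply/eqP/negPn/negP => /= /(cycle_crossing p_uniq up)[y [yp yu yX]].
have := cycle_crossing_edge cX yp yX; rewrite orbb => /(same_edge_next up) yu'.
by rewrite yu' eqxx in yu.
Qed.
End OnCycle.

Definition two_cut_region (D : {set T}) :=
  [/\ D \subset core e, ~ acyclic D &
      exists g h, [/\ nonbridge g, nonbridge h & cut2 D g h]].

(** The whole core is such a region, since no edge leaves it; any cycle edge can serve as both [g]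
    and [h]. *)
Lemma minimal_region : has_cycle e ->
  exists2 D, two_cut_region D & forall D', two_cut_region D' -> #|D| <= #|D'|.
Proof.
move=> [p [p_size p_uniq p_cycle]].
have region_core : two_cut_region (core e).
  split=> //; first by apply; exists p; split=> //; exact: cycle_core.
  have [u up] : exists x, x \in p by case: p p_size {p_uniq p_cycle} => // x s _; exists x; rewrite mem_head.
  exists (u, next p u), (u, next p u); split; try exact: nonbridge_cycle.
  by move=> x y _ yC _ _; rewrite yC.
elim: _.+1 {-2}(core e) (ltnSn #|core e|) region_core => // n IHn D Dn rD.
have [[D' [rD' D'D]]|none] := classic (exists D', two_cut_region D' /\ #|D'| < #|D|).
  by apply: (IHn D') => //; apply: leq_trans D'D _.
exists D => // D' rD'; rewrite leqNgt; apply/negP => D'D; by apply: none; exists D'.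
Qed.

(** An edge leaving [Z :\: D] ends in [Z] and in [D], so it is [g] or [h]. Were [g] not inside [Z],
    only [h] could leave this set, and [h] would be a bridge. *)
Lemma region_outside (D Z : {set T}) g h y u :
    cut2 D g h -> nonbridge h -> Z \subset core e ->
    (forall z t, z \in core e -> t \in core e -> e z t -> z \in Z -> t \notin Z -> z \in D) ->
    y \in Z -> y \notin D -> u \in core e -> u \in D ->
  g.1 \in Z /\ g.2 \in Z.
Proof.
move=> cD nh /subsetP ZC ZD yZ yD uC uD.
have ZDcut z t : z \in core e -> t \in core e -> e z t -> z \in Z :\: D -> t \notin Z :\: D ->
    t \in Z /\ (same_edge z t g.1 g.2 || same_edge z t h.1 h.2).
  move=> zC tC ezt; rewrite !inE => /andP[zD zZ]; rewrite negb_and negbK => tD.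
  have tZ : t \in Z.
    apply/negPn/negP => tZ; move: zD; by rewrite (ZD z t).
  have {}tD : t \in D by move: tD; rewrite tZ orbF.
  by split=> //; rewrite !(same_edgeC z); apply: cD; rewrite // e_sym.
have yX : y \in Z :\: D by rewrite inE yD.
have uX : u \notin Z :\: D by rewrite inE uD.
have [z [t [zC tC ezt zX tX]]] := core_crossing (ZC _ yZ) uC yX uX.
have gZ z' t' : z' \in core e -> t' \in core e -> e z' t' -> z' \in Z :\: D -> t' \notin Z :\: D ->
    same_edge z' t' g.1 g.2 -> g.1 \in Z /\ g.2 \in Z.
  move=> z'C t'C e' z'X t'X; have [t'Z _] := ZDcut z' t' z'C t'C e' z'X t'X.
  by have : z' \in Z by [move: z'X; rewrite inE => /andP[]]; move=> z'Z /same_edgeP[[<- <-]|[<- <-]].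
apply: NNPP => ngZ; have : cut2 (Z :\: D) h h.
  move=> z' t' z'C t'C e' z'X t'X; have [_ /orP[|->//]] := ZDcut z' t' z'C t'C e' z'X t'X.
  by move/(gZ _ _ z'C t'C e' z'X t'X)/ngZ.
move/nh => hX; have [_ /orP[/(gZ _ _ zC tC ezt zX tX)//|]] := ZDcut z t zC tC ezt zX tX.
by case/same_edgeP => -[zh th]; move: hX; rewrite -zh -th zX (negPf tX).
Qed.

(* Both edges of the cut lie on the cycle, hence inside [D]. If each side of the
   cut had a vertex outside [D], the two edges leaving [D] would be bridges;
   otherwise one side is strictly inside [D], and minimality applies to it. *)
Lemma acyclic_side (D : {set T}) (p : seq T) (X : {set T}) u h :
    two_cut_region D -> (forall D', two_cut_region D' -> #|D| <= #|D'|) ->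
    2 < size p -> uniq p -> path.cycle e p -> {subset p <= D} -> u \in p ->
    X \subset core e -> cut2 X (u, next p u) h ->
    (u \in X) != (next p u \in X) ->
  exists W, [/\ W = X \/ W = core e :\: X, W != set0 & acyclic W].
Proof.
move=> [DC Dcyc [g0 [h0 [ng nh cD]]]] Dmin p_size p_uniq p_cycle pD up XC cX uX.
have pC : {subset p <= core e} by exact: cycle_core.
have [y [yp yu yX]] := cycle_crossing p_uniq up uX.
have yh : same_edge y (next p y) h.1 h.2.
  have /orP[/(same_edge_next p_uniq p_size up) yu'|//] := cycle_crossing_edge p_uniq p_size p_cycle cX yp yX.
  by rewrite yu' eqxx in yu.
have nup : next p u \in p by rewrite mem_next.
have nyp : next p y \in p by rewrite mem_next.
have {yh}cX : cut2 X (u, next p u) (y, next p y).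
  move=> z t zC tC ezt zX tX; have /orP[->//|/same_edgeP zth] := cX z t zC tC ezt zX tX.
  apply/orP; right; apply/same_edgeP => /=.
  by case/same_edgeP: yh => -[-> ->]; case: zth => -[-> ->]; [left|right|right|left].
have inD (Z : {set T}) : cut2 Z (u, next p u) (y, next p y) ->
    forall z t, z \in core e -> t \in core e -> e z t -> z \in Z -> t \notin Z -> z \in D.
  move=> cZ z t zC tC ezt zZ tZ.
  by have /orP[/same_edgeP[[-> _]|[-> _]]|/same_edgeP[[-> _]|[-> _]]] := cZ z t zC tC ezt zZ tZ; apply: pD.
have cY := cut2C cX.
have side (Z : {set T}) : cut2 Z (u, next p u) (y, next p y) -> Z \subset core e ->
    (u \in Z) != (next p u \in Z) -> Z \subset D -> Z != set0 /\ acyclic Z.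
  move=> cZ ZC uZ ZD; split.
    apply/set0Pn; case: (boolP (u \in Z)) uZ => [uZ _|_]; first by exists u.
    by case: (boolP (next p u \in Z)) => // ? _; exists (next p u).
  apply: NNPP => Zcyc; have /Dmin : two_cut_region Z.
    by split=> //; exists (u, next p u), (y, next p y); split=> //; exact: nonbridge_cycle.
  rewrite leqNgt => /negP; apply; apply: proper_card; rewrite properE ZD /=.
  apply/subsetP => DZ; move: uZ; by rewrite !DZ ?pD.
have [XD|/subsetPn[y1 y1X y1D]] := boolP (X \subset D).
  by have [] := side X cX XC uX XD; exists X; split=> //; left.
have YC : core e :\: X \subset core e by rewrite subsetDl.
have uY : (u \in core e :\: X) != (next p u \in core e :\: X).
  by rewrite !inE !pC // !andbT; move: uX; do 2!case: (_ \in X).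
have [YD|/subsetPn[y2 y2Y y2D]] := boolP (core e :\: X \subset D).
  by have [] := side _ cY YC uY YD; exists (core e :\: X); split=> //; right.
have [gX _] := region_outside cD nh XC (inD _ cX) y1X y1D (pC _ up) (pD _ up).
have [gY _] := region_outside cD nh YC (inD _ cY) y2Y y2D (pC _ up) (pD _ up).
by move: gY; rewrite inE gX.
Qed.
End Cuts.

(** * Two labels: automorphisms that exchange them on the core *)

Lemma flipped_even (T : finType) (X : {set T}) (k : T -> bool) (f : T -> T) :
  injective f -> {in X, forall x, f x \in X /\ k (f x) = ~~ k x} -> ~~ odd #|X|.
Proof.
move=> f_inj fX; rewrite -(cardsID [set x | k x] X).
(* Each class of [k] is injected into the other by [f], so the two have equal size. *)
suff -> : #|X :&: [set x | k x]| = #|X :\: [set x | k x]| by rewrite addnn odd_double.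
have le_card (A B : {set T}) : f @: A \subset B -> #|A| <= #|B|.
  by move=> /subset_leq_card; rewrite card_imset.
apply/eqP; rewrite eqn_leq !le_card //; apply/subsetP => y /imsetP[x + ->]; rewrite !inE.
  by case/andP=> kx /fX[-> ->]; rewrite kx.
by case/andP=> /fX[-> ->] ->.
Qed.

Section TwoLabels.
Variables (T : finType) (e : rel T) (c : T -> nat).
Hypotheses (e_sym : symmetric e) (e_irr : irreflexive e) (conn : connected_graph e).
Hypotheses (cyc : has_cycle e) (c2 : vlabeling 2 c) (dist : vdistinguishing e c).
Variable v0 : T.
Hypotheses (v0C : v0 \in core e) (v0_deg : 2 < degree_in e (core e) v0).
Hypothesis no_edist : ~ has_edist e 2.

Let k0 x := c x == 1.

Lemma k0_eq x y : k0 x = k0 y -> c x = c y.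
Proof. by rewrite /k0; have := c2 x; have := c2 y; case: (c x) (c y) => [|[]] // [|[]]. Qed.

(** This much is forced by the tree edges with the core as root set, whatever labels are used inside
    the core. *)
Definition off_core (a : {perm T}) := is_aut e a /\ forall x, x \notin core e -> c (a x) = c x.

Lemma off_core_id a : off_core a -> {in core e, forall x, k0 (a x) = k0 x} -> a = 1%g.
Proof.
move=> [aut off] k0a; apply: dist => // x.
by have [xC|/off//] := boolP (x \in core e); apply: k0_eq; exact: k0a.
Qed.

(** By [no_edist], the encoding of [w] over the core is not distinguishing. The lemma turns each
    attempted labeling of the core into a nontrivial automorphism. *)
Lemma bad_automorphism (w : T -> T -> bool) : (forall x y, w x y = w y x) ->
  exists a, [/\ off_core a, a <> 1%g &
    forall x y, x \in core e -> y \in core e -> e x y -> w (a x) (a y) = w x y].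
Proof.
move=> wC; apply: NNPP => none; apply: no_edist.
have C0 : core e != set0 by apply/set0Pn; exists v0.
pose w' x y := nat_of_bool (w x y).
apply: (@has_edist_of_encoding _ _ _ (ball_reach conn C0) c w') => //.
- by move=> x y; rewrite /w'; case: (w x y).
- by move=> x y; rewrite /w' wC.
move=> a aut pres; have aC := core_aut aut; split=> // x xC.
have [->|a1] := classic (a = 1%g); first by rewrite perm1.
case: none; exists a; split=> //.
  by split=> // y yC; apply: encoding_off pres aC _ yC.
move=> y z yC zC eyz; have := encoding_root pres aC yC zC eyz.
by rewrite /w'; do 2!case: (w _ _).
Qed.

Lemma const_on_core (d : T -> bool) :
  (forall x y, x \in core e -> y \in core e -> e x y -> d x = d y) ->
  {in core e &, forall x y, d x = d y}.
Proof.
move=> dE x y xC yC; have [//|dxy] := eqVneq (d x) (d y).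
have xX : x \in [set z | d z == d x] by rewrite inE.
have yX : y \notin [set z | d z == d x] by rewrite inE eq_sym.
have [z [t [zC tC ezt]]] := core_crossing e_sym conn xC yC xX yX.
by rewrite !inE (dE z t) // => ->.
Qed.

Definition flips (a : {perm T}) := off_core a /\ {in core e, forall x, k0 (a x) = ~~ k0 x}.

Lemma flips_unique a b : flips a -> flips b -> a = b.
Proof.
move=> [[auta offa] fa] [[autb offb] fb].
apply: (mulIg b^-1%g); rewrite mulgV; have bVC x : (b^-1%g x \in core e) = (x \in core e).
  by rewrite core_aut //; exact: is_autV.
apply: off_core_id => [|x xC]; first split; first exact/is_autM/is_autV.
  move=> x xC; rewrite permM -(offb (b^-1%g (a x))); first by rewrite permKV offa.
  by rewrite bVC core_aut.
have axC : a x \in core e by rewrite core_aut.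
by rewrite permM -[LHS]negbK -fb ?bVC // permKV fa // negbK.
Qed.

(** For the sum of the labels modulo 2, the change of label under a bad automorphism is the same at
    both ends of each core edge, hence constant on the core. No change would force the identity. *)
Lemma flip_exists : exists tau, flips tau.
Proof.
have [a [oa a1 aw]] := @bad_automorphism (fun x y => k0 x (+) k0 y) (fun x y => addbC _ _).
exists a; split=> // x xC; have := @const_on_core (fun x => k0 (a x) (+) k0 x).
move=> /(_ _)/wrap[y z yC zC eyz|const]; first by have := aw y z yC zC eyz; do 4!case: (k0 _).
case E: (k0 (a x) (+) k0 x); first by move: E; do 2!case: (k0 _).
case: a1; apply: off_core_id => // y yC; have := const x y xC yC; rewrite E.
by do 2!case: (k0 _).
Qed.

Lemma core_card_even : ~~ odd #|core e|.
Proof.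
have [tau [[aut _] ktau]] := flip_exists.
by apply: (flipped_even (@perm_inj _ tau) (k := k0)) => x xC; rewrite core_aut // ktau.
Qed.

(** A cycle in [D] without a vertex of core degree above 2 would be the whole core, against [v0].
    Reversing the cycle, if necessary, keeps [tau] from sending [b] to its successor. *)
Lemma branch_edge (tau : {perm T}) : exists D p b,
  [/\ two_cut_region e D /\ (forall D', two_cut_region e D' -> #|D| <= #|D'|),
      [/\ 2 < size p, uniq p, path.cycle e p & {subset p <= D}],
      b \in p, 2 < degree_in e (core e) b & tau b != next p b].
Proof.
have [D rD Dmin] := minimal_region e_sym cyc.
have [_ Dcyc _] := rD; have [p [p_size p_uniq p_cycle pD]] := NNPP _ Dcyc.
have [b bp b_deg] : exists2 b, b \in p & 2 < degree_in e (core e) b.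
  have [/hasP[b bp b2]|/hasPn none] := boolP (has (fun b => 2 < degree_in e (core e) b) p).
    by exists b.
  have v0p : v0 \in p.
    apply: (core_eq_cycle e_sym conn p_uniq p_size p_cycle) v0C => x /none; by rewrite -leqNgt.
  by have := none _ v0p; rewrite v0_deg.
have [taub|taub] := eqVneq (tau b) (next p b); last by exists D, p, b.
exists D, (rev p), b; split=> //; rewrite ?mem_rev //.
  split; rewrite ?size_rev ?rev_uniq // ?rev_cycle.
    by rewrite -(eq_cycle (e := e)) // => x y; rewrite e_sym.
  by move=> x; rewrite mem_rev; exact: pD.
by rewrite next_rev // taub next_neq_prev.
Qed.

Lemma same_edge_perm (a : {perm T}) x y u v :
  same_edge (a x) (a y) u v = same_edge x y (a^-1%g u) (a^-1%g v).
Proof.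
by rewrite -{1}(permKV a u) -{1}(permKV a v) /same_edge !(inj_eq (@perm_inj _ a)).
Qed.

(** * Changing the label of one edge at a branch vertex *)

Section Thread.
Variables (tau : {perm T}) (D : {set T}) (p : seq T) (b : T).
Hypotheses (tau_flips : flips tau) (rD : two_cut_region e D)
  (Dmin : forall D', two_cut_region e D' -> #|D| <= #|D'|).
Hypotheses (p_size : 2 < size p) (p_uniq : uniq p) (p_cycle : path.cycle e p) (pD : {subset p <= D}).
Hypotheses (bp : b \in p) (b_deg : 2 < degree_in e (core e) b) (taub : tau b != next p b).
Let x := next p b.

Let pC : {subset p <= core e} := cycle_core e_sym p_uniq p_size p_cycle.
Let xp : x \in p. Proof. by rewrite mem_next. Qed.
Let bC : b \in core e. Proof. exact: pC. Qed.
Let xC : x \in core e. Proof. exact: pC. Qed.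
Let exb : e b x. Proof. exact: next_cycle. Qed.

(** The label of [bx] is toggled in the sum modulo 2 of [k]. Under a bad automorphism the change of
    [k] then switches exactly across [bx] and across its preimage. If these agree, the change is
    constant, and [a] is the identity or [tau], both impossible. Otherwise they form a cut with an
    acyclic side [W], which contains neither [b] nor its preimage, these having degree above 2. The
    bit [s] tells on which side the change occurs. *)
Lemma thread (k : T -> bool) : (forall z, z != x -> k z = k0 z) ->
    (2 < degree_in e (core e) x -> k x = k0 x) ->
  degree_in e (core e) x = 2 /\
  exists (a : {perm T}) (W : {set T}) (s : bool), [/\ off_core a /\ ~~ same_edge (a^-1%g b) (a^-1%g x) b x,
    [/\ W \subset core e, acyclic e W & cut2 e W (b, x) (a^-1%g b, a^-1%g x)],
    x \in W /\ a^-1%g x \in W &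
    {in core e, forall z, k (a z) (+) k z = s (+) (z \in W)}].
Proof.
move=> kx kdeg; pose w z t := k z (+) k t (+) same_edge z t b x.
have [|a [oa a1 aw]] := @bad_automorphism w.
  by move=> z t; rewrite /w same_edgeC (addbC (k z)).
have [aut off] := oa; set h1 := a^-1%g b; set h2 := a^-1%g x.
have aC := core_aut aut; have h1C : h1 \in core e by rewrite -aC permKV.
have h1deg : 2 < degree_in e (core e) h1 by rewrite -(core_degree_aut aut) permKV.
pose d z := k (a z) (+) k z.
have dE z t : z \in core e -> t \in core e -> e z t ->
    d z (+) d t = same_edge z t b x (+) same_edge z t h1 h2.
  move=> zC tC ezt; have := aw z t zC tC ezt; rewrite /w /d same_edge_perm -/h1 -/h2.
  by case: (k (a z)) (k (a t)) (k z) (k t) (same_edge _ _ b x) (same_edge _ _ h1 h2)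
    => [] [] [] [] [] [].
have [hg|hg] := boolP (same_edge h1 h2 b x).
  have dconst : {in core e &, forall z t, d z = d t}.
    apply: const_on_core => z t zC tC ezt; have := dE z t zC tC ezt.
    have -> : same_edge z t b x = same_edge z t h1 h2.
      case/same_edgeP: hg => -[-> ->] //.
      by rewrite /same_edge orbC.
    by rewrite addbb; case: (d z) (d t) => [] [].
  have kid : {in core e, forall z, k0 (a z) = k0 z} -> False by move/(off_core_id oa).
  case/same_edgeP: hg => -[hb hx].
    have ab : a b = b by rewrite -{1}hb permKV.
    have ax : a x = x by rewrite -{1}hx permKV.
    case: kid => z zC; have := dconst z b zC bC; rewrite /d ab addbb => /negbT.
    have [->|zx] := eqVneq z x; first by rewrite ax.
    have azx : a z != x by rewrite -{1}ax (inj_eq perm_inj).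
    by rewrite !kx //; do 2!case: (k0 _).
  have ab : a b = x by rewrite -hx permKV.
  have x_deg : 2 < degree_in e (core e) x by rewrite -ab core_degree_aut.
  have {}kx z : k z = k0 z by have [->|/kx//] := eqVneq z x; exact: kdeg.
  have [db|db] := boolP (d b).
    suff at_ : a = tau by move: taub; rewrite -at_ ab eqxx.
    apply: flips_unique => //; split=> // z zC; have := dconst z b zC bC.
    by rewrite db /d !kx; do 2!case: (k0 _).
  case: kid => z zC; have := dconst z b zC bC.
  by rewrite (negPf db) /d !kx; do 2!case: (k0 _).
pose X := [set z in core e | d z].
have XC : X \subset core e by apply/subsetP => z; rewrite inE => /andP[].
have cX : cut2 e X (b, x) (h1, h2).
  move=> z t zC tC ezt; rewrite !inE zC tC /= => dz dt; have := dE z t zC tC ezt.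
  by rewrite dz (negPf dt); do 2!case: same_edge.
have bX : (b \in X) != (next p b \in X).
  rewrite -/x !inE bC xC /=; have := dE b x bC xC exb.
  have -> : same_edge b x b x by rewrite /same_edge !eqxx.
  have -> : same_edge b x h1 h2 = false.
    apply: contraNF hg => /same_edgeP[[-> ->]|[-> ->]]; by rewrite /same_edge !eqxx ?orbT.
  by case: (d b) (d x) => [] [].
have [W [WX W0 Wa]] := acyclic_side e_sym conn rD Dmin p_size p_uniq p_cycle pD bp XC cX bX.
have WC : W \subset core e by case: WX => ->; rewrite ?subsetDl.
have cW : cut2 e W (b, x) (h1, h2) by case: WX => ->; rewrite // ; exact: cut2C.
have bW : (b \in W) != (x \in W).
  by case: WX => -> //; rewrite !in_setD bC xC !andbT; move: bX; rewrite -/x; do 2!case: (_ \in X).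
have Wdeg z : z \in W -> degree_in e (core e) z = 2.
  by apply: acyclic_degree => //; exact: cut2_boundary cW.
have bNW : b \notin W by apply/negP => /Wdeg b2; move: b_deg; rewrite b2.
have xW : x \in W by move: bW; rewrite (negPf bNW); case: (x \in W).
have h1NW : h1 \notin W by apply/negP => /Wdeg h2'; rewrite h2' in h1deg.
split; first exact: Wdeg.
(* Otherwise [bx] alone would leave [W], while an acyclic set has at least two boundary edges. *)
have h2W : h2 \in W.
  apply/negPn/negP => h2NW; have := acyclic_boundary2 e_sym e_irr W0 WC Wa.
  rewrite ltnNge => /negP; apply; rewrite -(cards1 (x, b)).
  apply/subset_leq_card/subsetP => -[z t]; rewrite !inE /= => /and3P[zW /andP[tW tC] ezt].
  have /orP[/same_edgeP[]|/same_edgeP[]] := cW z t (subsetP WC _ zW) tC ezt zW tW; move=> -[/= zE tE].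
  - by rewrite zE (negPf bNW) in zW.
  - by rewrite zE tE.
  - by rewrite zE (negPf h1NW) in zW.
  - by rewrite zE (negPf h2NW) in zW.
have [s sE] : exists s, {in core e, forall z, d z = s (+) (z \in W)}.
  case: WX => WX; [exists false|exists true] => z zC; rewrite WX !inE zC /= ?andbT //.
  by rewrite negbK.
by exists a, W, s.
Qed.

(* The labels at [b] and [x] are compared for [k0] and for [k0] changed at [x]:
   both colorings yield the same thread from [b] through [x], which must then
   consist of [x] alone; the automorphism flips all other core vertices, so the
   core is odd. *)
Lemma two_labels_contradiction : False.
Proof.
pose k1 z := k0 z (+) (z == x).
have [|//|x2 [a0 [W0 [s0 [[[aut0 off0] hg0] [W0C W0a cW0] [xW0 h2W0] dE0]]]]] := @thread k0.
  by [].
have [||_ [a1 [W1 [s1 [[[aut1 off1] hg1] [W1C W1a cW1] [xW1 h2W1] dE1]]]]] := @thread k1.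
- by move=> z zx; rewrite /k1 (negPf zx) addbF.
- by rewrite x2.
have nbr (a : {perm T}) : is_aut e a -> [/\ a^-1%g b \in core e,
    2 < degree_in e (core e) (a^-1%g b) & e (a^-1%g x) (a^-1%g b)].
  move=> aut; have autV := is_autV aut.
  by rewrite core_aut // core_degree_aut // autV e_sym.
have degW (W : {set T}) h z : W \subset core e -> acyclic e W -> cut2 e W (b, x) h -> z \in W ->
    degree_in e (core e) z = 2.
  by move=> WC Wa cW; apply: acyclic_degree => //; exact: cut2_boundary cW.
have branchNW (W : {set T}) h z : W \subset core e -> acyclic e W -> cut2 e W (b, x) h ->
    2 < degree_in e (core e) z -> z \notin W.
  by move=> WC Wa cW z3; apply/negP => /(degW W h z WC Wa cW) z2; rewrite z2 in z3.
have [h1C0 h1d0 eh0] := nbr a0 aut0; have [h1C1 h1d1 eh1] := nbr a1 aut1.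
(* If the second edges of the two cuts differed, only [bx] could leave the intersection of the two
   threads, but [bx] lies on a cycle. *)
have same_h : same_edge (a0^-1%g b) (a0^-1%g x) (a1^-1%g b) (a1^-1%g x).
  apply/negPn/negP => hne; pose I := W0 :&: W1.
  have crossing (a a' : {perm T}) (W W' : {set T}) z t :
      W \subset core e -> acyclic e W -> cut2 e W (b, x) (a^-1%g b, a^-1%g x) ->
      W' \subset core e -> acyclic e W' -> cut2 e W' (b, x) (a'^-1%g b, a'^-1%g x) ->
      2 < degree_in e (core e) (a^-1%g b) ->
      ~~ same_edge (a^-1%g b) (a^-1%g x) b x ->
      ~~ same_edge (a^-1%g b) (a^-1%g x) (a'^-1%g b) (a'^-1%g x) ->
      z \in W -> z \in W' -> t \in core e -> e z t -> t \notin W -> same_edge z t b x.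
    move=> WC Wa cW W'C W'a cW' hdeg hg hh zW zW' tC ezt tW.
    have zC := subsetP WC _ zW.
    have /orP[//|/same_edgeP[[zE _]|[zE tE]]] := cW z t zC tC ezt zW tW.
      by have := branchNW W _ _ WC Wa cW hdeg; move: zE => /= <- /negP[].
    have tW' : t \notin W' by rewrite tE; exact: (branchNW W' _ _ W'C W'a cW' hdeg).
    have := cW' z t zC tC ezt zW' tW'.
    by rewrite zE tE /= !(same_edgeC (a^-1%g x)) (negPf hg) (negPf hh).
  have cI : cut2 e I (b, x) (b, x).
    move=> z t zC tC ezt; rewrite !inE => /andP[zW0 zW1]; rewrite orbb negb_and => /orP[tW|tW].
      by apply: (crossing a0 a1 W0 W1).
    apply: (crossing a1 a0 W1 W0) => //; apply: contra hne => /same_edgeP[[-> ->]|[-> ->]];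
      by rewrite /same_edge !eqxx ?orbT.
  have := nonbridge_cycle e_sym p_uniq p_size p_cycle bp cI; rewrite /= -/x !inE xW0 xW1.
  by rewrite (negPf (branchNW W0 _ _ W0C W0a cW0 b_deg)).
have [hb hx] : a0^-1%g b = a1^-1%g b /\ a0^-1%g x = a1^-1%g x.
  case/same_edgeP: same_h => // -[hb _]; move: h1d0; rewrite hb core_degree_aut ?x2 //.
  exact: is_autV.
have neq_x z : 2 < degree_in e (core e) z -> z != x.
  by apply: contraTneq => ->; rewrite x2.
have h2C0 : a0^-1%g x \in core e := subsetP W0C _ h2W0.
have b'W0 := branchNW W0 _ _ W0C W0a cW0 h1d0.
have b'W1 := branchNW W1 _ _ W1C W1a cW1 h1d1.
(* The two changes are compared at the preimage of [b], outside both threads, where [k0] and [k1]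
   agree as they do at [b]. *)
have s01 : s1 = s0.
  have := dE0 _ h1C0; have := dE1 _ h1C1; rewrite !permKV (negPf b'W0) (negPf b'W1) !addbF.
  by rewrite /k1 (negPf (neq_x _ b_deg)) (negPf (neq_x _ h1d1)) !addbF -hb => <- <-.
(* At the preimage of [x] the changes of [k0] and [k1] agree as well. But [k1] differs from [k0] at
   [x], so it must also differ at this preimage, which is therefore [x]. *)
have d0x := dE0 _ h2C0; have := dE1 (a1^-1%g x); rewrite h2W1 -hx => /(_ h2C0).
rewrite permKV h2W0 in d0x; rewrite {1}hx permKV /k1 eqxx s01.
have [h2x _|_] := eqVneq (a0^-1%g x) x; last first.
  by move: d0x; case: (k0 x) (k0 (a0^-1%g x)) (s0) => [] [] [].
have s0T : s0 by move: d0x; rewrite h2x addbb; case: (s0).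
have a0x : a0 x = x by rewrite -{1}h2x permKV.
(* The two core neighbours of [x] are [b] and its preimage, both outside [W0]. The rest of [W0]
   would thus have an empty boundary. *)
have W0E : W0 = [set x].
  apply/eqP; rewrite eqEsubset sub1set xW0 andbT; apply/subsetP => z zW; rewrite inE.
  apply/negPn/negP => zx; have W'0 : W0 :\ x != set0 by apply/set0Pn; exists z; rewrite !inE zx.
  have W'C : W0 :\ x \subset core e by apply: subset_trans W0C; rewrite subsetDl.
  have W'a : acyclic e (W0 :\ x).
    move=> [q [q1 q2 q3 qW]]; apply: W0a; exists q; split=> // u /qW.
    by rewrite inE => /andP[].
  have := acyclic_boundary2 e_sym e_irr W'0 W'C W'a; rewrite (_ : boundary _ _ = set0) ?cards0 //.
  apply/setP => -[u t]; rewrite !inE /=; apply/negP => /and3P[/andP[ux uW] /andP[tW tC] eut].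
  have uC := subsetP W0C _ uW; have [tx|tx] := eqVneq t x.
    have xbh : [set b; a0^-1%g b] \subset [set y in core e | e x y].
      apply/subsetP => y; rewrite !inE => /orP[]/eqP ->; first by rewrite bC e_sym exb.
      by rewrite h1C0 -{1}h2x eh0.
    have : #|[set b; a0^-1%g b]| = 2.
      rewrite cards2; case: eqVneq => // hb'; case/negP: hg0.
      by rewrite -hb' h2x /same_edge !eqxx.
    move=> cb; have : u \in [set b; a0^-1%g b].
      have /eqP -> : [set b; a0^-1%g b] == [set y in core e | e x y].
        by rewrite eqEcard xbh cb -x2 /=.
      by rewrite inE uC e_sym -tx.
    rewrite !inE => /orP[]/eqP uE; first by move: (branchNW W0 _ _ W0C W0a cW0 b_deg); rewrite -uE uW.
    by move: b'W0; rewrite -uE uW.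
  have tW0 : t \notin W0 by move: tW; rewrite tx.
  have := cW0 u t uC tC eut uW tW0; rewrite h2x /= => /orP[]/same_edgeP[[uE _]|[uE _]].
  - by move: (branchNW W0 _ _ W0C W0a cW0 b_deg); rewrite -uE uW.
  - by rewrite uE eqxx in ux.
  - by move: b'W0; rewrite -uE uW.
  - by rewrite uE eqxx in ux.
have := core_card_even; rewrite (cardsD1 x) xC /= negbK.
apply/negP; apply: (flipped_even (@perm_inj _ a0) (k := k0)) => z.
rewrite !inE => /andP[zx zC]; rewrite core_aut // zC -{1}a0x (inj_eq perm_inj) zx; split=> //.
by have := dE0 z zC; rewrite W0E inE (negPf zx) s0T; do 2!case: (k0 _).
Qed.
End Thread.
End TwoLabels.

(** * Assembling the cases *)

Lemma has_edist_2 (T : finType) (e : rel T) (c : T -> nat) :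
    symmetric e -> irreflexive e -> connected_graph e -> has_cycle e ->
    vlabeling 2 c -> vdistinguishing e c -> has_edist e 2.
Proof.
move=> e_sym e_irr conn cyc c2 dist; have [p [p_size p_uniq p_cycle]] := cyc.
have [/forallP deg2|/forallPn[v]] := boolP [forall v in core e, degree_in e (core e) v <= 2].
  apply: (has_edist_core_cycle e_sym conn p_uniq p_size p_cycle _ c2 dist) => // x xp.
  by have := deg2 x; rewrite (cycle_core e_sym p_uniq p_size p_cycle xp).
rewrite negb_imply -ltnNge => /andP[vC v_deg]; apply: NNPP => no.
have [tau tauP] := flip_exists e_sym conn c2 dist vC no.
have [D [p' [b [[rD Dmin] [p'1 p'2 p'3 p'D] bp b_deg taub]]]] :=
  branch_edge e_sym conn cyc vC v_deg tau.
exact: (two_labels_contradiction e_sym e_irr conn c2 dist vC no tauP rD Dmin p'1 p'2 p'3 p'D bp b_deg taub).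
Qed.

Lemma has_edist_of_vdist (T : finType) (e : rel T) r :
    simple_graph e -> connected_graph e -> has_cycle e ->
  has_vdist e r -> has_edist e r.
Proof.
move=> [e_sym e_irr] conn cyc [c [cr dist]].
case: r cr => [|[|[|r]]] cr.
(* No labels are impossible because a cycle has a vertex. With one label, the only automorphism is
   the identity, so a constant edge labeling is distinguishing. *)
- by case: cyc => -[|x p] [] // _ _ _; have := cr x.
- exists (fun _ _ => 0); split=> // a aut _; apply: dist => // x.
  by have := cr x; have := cr (a x); case: (c x) (c (a x)) => [|?] [|?].
- exact: has_edist_2 dist.
- exact: has_edist_ge3 dist _.
Qed.

Theorem theorem2p1 (T : finType) (e : rel T) :
  simple_graph e -> connected_graph e -> has_cycle e ->
  (exists d, has_edist e d) /\ dist_index e <= dist_number e.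
Proof.
move=> simple conn cyc.
have edist : has_edist e (dist_number e).
  apply: has_edist_of_vdist => //; rewrite /dist_number.
  by case: ex_minnP => r /Defs.decPP.
have ex : exists d, has_edist e d by exists (dist_number e).
split=> //; rewrite /dist_index.
case: ClassicalDescription.excluded_middle_informative => // h.
by case: ex_minnP => d _; apply; apply: Defs.decPI.
Qed.
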